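(* Let $\theta$ and $\alpha$ be inner functions, let $h\in K_\alpha^\infty$ with $\|h\|_\infty<1$, and let $$\gamma=\frac{\theta\alpha-\alpha\overline h}{1-h\theta},$$ which is an inner function. Let $p\in\mathbb C$, $|p|<1$, and define $$m_p^\gamma=\frac{\sqrt{1-|p|^2}}{1-p\gamma},\qquad \gamma_p=\frac{\gamma-\overline p}{1-p\gamma}.$$ If $\alpha\preceq\gamma_p$, then $$\ker T_{\overline\theta-h}=(m_p^\gamma)^{-1}K_{\gamma_p/\alpha}$$ is an isometric model space representation of $\ker T_{\overline\theta-h}$.
   Context: $H^2=H^2(\mathbb D)$ is the Hardy space of the unit disk, identified with a closed subspace of $L^2(\mathbb T)$, $P^+:L^2(\mathbb T)\to H^2$ is the orthogonal projection, and $H^\infty$ is the algebra of bounded analytic functions on $\mathbb D$ (identified with boundary functions on $\mathbb T$). For $g\in L^\infty(\mathbb T)$, $T_g:H^2\to H^2$, $T_gf=P^+(gf)$. For $\theta$ inner, $K_\theta=\ker T_{\overline\theta}=H^2\ominus\theta H^2$. For inner $\alpha$, $K_\alpha^\infty:=\{f\in H^\infty:\overline\alpha f\in\overline{H^\infty}\}$, where $\overline{H^\infty}$ denotes the set of complex conjugates on $\mathbb T$ of functions in $H^\infty$. For inner functions, $\alpha\preceq\beta$ means $\alpha$ divides $\beta$, i.e. $\beta\overline\alpha\in H^\infty$. An isometric model space representation of $\ker T_g$ is an equality $\ker T_g=wK_\beta$, $\beta$ inner, in which multiplication by $w$ is an isometry (in the $L^2$ norm) from $K_\beta$ onto $\ker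 T_g$. *)

(* Defs.v *)
From HB Require Import structures.
From mathcomp Require Import all_boot all_order all_algebra.
From mathcomp Require Import all_classical all_reals all_analysis.
From mathcomp Require Import complex.
Set Implicit Arguments.
Unset Strict Implicit.
Unset Printing Implicit Defensive.
Import Order.TTheory GRing.Theory Num.Theory.
Import ComplexField.Normc.
Import numFieldNormedType.Exports.
Local Open Scope classical_set_scope.
Local Open Scope ring_scope.
Local Open Scope complex_scope.

(* A function on the unit circle T is given by its values at e^{it}, that is,
   as f : R -> R[i] with f t standing for the value at e^{it}.  Only
   t in [0, 2pi] matters: functions on T are compared almost everywhere for
   the normalized arc length [arc]. [normc] is the R-valued modulus. *)

Lemma two_pi_gt0 (R : realType) : 0 < (pi : R) *+ 2.
Proof. by rewrite mulrn_wgt0 // pi_gt0. Qed.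

Definition arc (R : realType) : probability (measurableTypeR R) R :=
  uniform_prob (two_pi_gt0 R).

Definition expi (R : realType) (t : R) : R[i] := cos t +i* sin t.

Definition cmeasurable (R : realType) (f : R -> R[i]) : Prop :=
  measurable_fun [set: measurableTypeR R] (fun t => complex.Re (f t)) /\
  measurable_fun [set: measurableTypeR R] (fun t => complex.Im (f t)).

Definition normL2 (R : realType) (f : R -> R[i]) : \bar R :=
  ('N[arc R]_2%:E[(fun t => (normc (f t))%:E)])%E.

Definition normLinf (R : realType) (f : R -> R[i]) : \bar R :=
  ('N[arc R]_(+oo)[(fun t => (normc (f t))%:E)])%E.

Definition L2 (R : realType) : set (R -> R[i]) :=
  [set f | cmeasurable f /\ (normL2 f < +oo)%E].

Definition Linf (R : realType) : set (R -> R[i]) :=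
  [set f | cmeasurable f /\ (normLinf f < +oo)%E].

Definition dotL2 (R : realType) (f g : R -> R[i]) : R[i] :=
  (\int[arc R]_t complex.Re (f t * (g t)^*))
    +i* (\int[arc R]_t complex.Im (f t * (g t)^*)).

Definition dilate (R : realType) (F : R[i] -> R[i]) (r : R) : R -> R[i] :=
  fun t => F (r%:C * expi t).

Definition analytic_disc (R : realType) (F : R[i] -> R[i]) : Prop :=
  exists a : nat -> R[i], forall z : R[i], normc z < 1 ->
    (\sum_(0 <= k < n) a k * z ^+ k : R[i]^o) @[n --> \oo] --> (F z : R[i]^o).

Definition H2_disc (R : realType) : set (R[i] -> R[i]) :=
  [set F | analytic_disc F /\ exists M : R, forall r : R, 0 <= r < 1 ->
     (normL2 (dilate F r) <= M%:E)%E].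

Definition Hinf_disc (R : realType) : set (R[i] -> R[i]) :=
  [set F | analytic_disc F /\ exists M : R, forall z : R[i], normc z < 1 ->
     normc (F z) <= M].

(* f is the boundary function of F: radial limits almost everywhere. *)
Definition boundary_fun (R : realType) (F : R[i] -> R[i]) (f : R -> R[i]) :
    Prop :=
  \forall t \ae arc R,
    (dilate F r t : R[i]^o) @[r --> (1 : R)^'-] --> (f t : R[i]^o).

(* H^2 and H^infty, identified with spaces of boundary functions on T. *)
Definition H2 (R : realType) : set (R -> R[i]) :=
  [set f | L2 f /\ exists2 F, H2_disc F & boundary_fun F f].

Definition Hinf (R : realType) : set (R -> R[i]) :=
  [set f | Linf f /\ exists2 F, Hinf_disc F & boundary_fun F f].

Definition fconj (R : realType) (f : R -> R[i]) : R -> R[i] :=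
  fun t => (f t)^*.

Definition inner_fun (R : realType) (theta : R -> R[i]) : Prop :=
  Hinf theta /\ \forall t \ae arc R, normc (theta t) = 1.

(* P^+ and T_g are given by their graphs, since functions on T are not
   quotiented by a.e. equality: [is_Pplus f u] is P^+ f = u, i.e. u is the
   orthogonal projection of f on H^2, and [is_toeplitz g f u] is T_g f = u. *)
Definition is_Pplus (R : realType) (f u : R -> R[i]) : Prop :=
  [/\ L2 f, H2 u & forall v, H2 v -> dotL2 (fun t => f t - u t) v = 0].

Definition is_toeplitz (R : realType) (g f u : R -> R[i]) : Prop :=
  H2 f /\ is_Pplus (fun t => g t * f t) u.

Definition ker_toeplitz (R : realType) (g : R -> R[i]) : set (R -> R[i]) :=
  [set f | is_toeplitz g f (fun=> 0)].

Definition model_space (R : realType) (theta : R -> R[i]) : set (R -> R[i]) :=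
  ker_toeplitz (fconj theta).

Definition model_space_inf (R : realType) (alpha : R -> R[i]) :
    set (R -> R[i]) :=
  [set f | Hinf f /\
     (@fconj R @` @Hinf R) (fun t => fconj alpha t * f t)].

Definition inner_divides (R : realType) (alpha beta : R -> R[i]) : Prop :=
  Hinf (fun t => beta t * fconj alpha t).

(* w K, closed under a.e. equality of measurable functions. *)
Definition fmul_set (R : realType) (w : R -> R[i]) (K : set (R -> R[i])) :
    set (R -> R[i]) :=
  [set f | cmeasurable f /\
     exists2 k, K k & f = (fun t => w t * k t) %[ae arc R]].

(* ker T_g = w K_beta is an isometric model space representation. *)
Definition isometric_representation (R : realType) (g w beta : R -> R[i]) :
    Prop :=
  [/\ inner_fun beta,
      ker_toeplitz g = fmul_set w (model_space beta)
    & forall k, model_space beta k -> normL2 (fun t => w t * k t) = normL2 k].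

Definition gamma_fun (R : realType) (theta alpha h : R -> R[i]) : R -> R[i] :=
  fun t => (theta t * alpha t - alpha t * fconj h t) / (1 - h t * theta t).

Definition crofoot_weight (R : realType) (p : R[i]) (gamma : R -> R[i]) :
    R -> R[i] :=
  fun t => (Num.sqrt (1 - normc p ^+ 2))%:C / (1 - p * gamma t).

Definition frostman_shift (R : realType) (p : R[i]) (gamma : R -> R[i]) :
    R -> R[i] :=
  fun t => (gamma t - p^*) / (1 - p * gamma t).

(* Main.v *)
From mathcomp Require Import all_boot all_order all_algebra.
From mathcomp Require Import all_classical all_reals all_analysis.
From mathcomp Require Import complex ring lra measurable_realfun ess_sup_inf hoelder.
Require Import Defs.
Import Order.TTheory GRing.Theory Num.Theory.
Import ComplexField.Normc.
Import numFieldNormedType.Exports.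

(** On the circle |theta| = |alpha| = 1, and two identities carry the proof.

    First, theta - h^* = theta (1 - h theta)^*, so that
    gamma = alpha theta (1 - h theta)^* / (1 - h theta) is unimodular; it is
    analytic because alpha h^* is the conjugate of alpha^* h, hence in H^oo,
    and because 1 - h theta is invertible in H^oo.  It follows that
    theta^* - h = gamma^* alpha (1 - h theta)^*.

    Secondly, gamma - p^* = gamma (1 - p gamma)^*, whence, for
    beta = gamma_p / alpha, beta^* = gamma^* alpha (1 - p gamma) / (1 - p gamma)^*.

    Hence beta^* = u^* (theta^* - h) / m_p, where 1 / m_p and
    u = c / ((1 - p gamma) (1 - h theta)), c = sqrt (1 - |p|^2), are units of
    the algebra H^oo.  Multiplying a symbol by w and by the conjugate of u
    amounts to dividing the functions of the kernel by w and to replacing the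
    test functions v by u v, which leaves H^2 globally invariant; so
    ker T_(theta^* - h) = (1 / m_p) K_beta ([ker_toeplitz_factor]).

    For the isometry, |k|^2 - |k / m_p|^2 is, up to the factor 2 / c^2, the real
    part of beta^* k v^* with v = p alpha (1 - p gamma) k in H^2
    ([crofoot_identity]); the integral of that real part vanishes when k is in
    K_beta.

    What remains is that H^oo is an algebra acting on H^2, in which 1 - f is
    invertible when |f| <= c < 1 almost everywhere on the circle
    ([Hinf_inv]).  The delicate point is to control f inside the disc by its
    boundary values.  The Taylor coefficients of a bounded analytic function
    are bounded by its essential supremum on the circle (they are means over
    circles of radius r, and r tends to 1 by dominated convergence); applied
    to all the powers f^n, this gives both |f| <= c inside the disc and the
    convergence of the coefficients of the geometric series of f. *)

Set Implicit Arguments.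
Unset Strict Implicit.
Unset Printing Implicit Defensive.
Local Open Scope classical_set_scope.
Local Open Scope ring_scope.
Local Open Scope complex_scope.

(** * The modulus and the topology of the complex numbers *)

Section Normc.
Variable R : realType.
Implicit Types x y z : R[i].

Lemma norm_normc z : `|z| = (normc z)%:C.
Proof. by []. Qed.

Lemma normc_ge0 z : 0 <= normc z.
Proof. by case: z => a b; exact: sqrtr_ge0. Qed.

Lemma normcD x y : normc (x + y) <= normc x + normc y.
Proof. exact: le_normcD. Qed.

Lemma normc_opp z : normc (- z) = normc z.
Proof. exact: normcN. Qed.

Lemma normcB x y : normc (x - y) <= normc x + normc y.
Proof. by rewrite -(normc_opp y) normcD. Qed.

Lemma normc_distC x y : normc (x - y) = normc (y - x).
Proof. by rewrite -normc_opp opprB. Qed.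

Lemma normc_le_dist x y : normc x - normc y <= normc (x - y).
Proof. by rewrite lerBlDr -{1}(subrK y x) normcD. Qed.

Lemma normc_conj z : normc z^* = normc z.
Proof. by case: z => a b /=; rewrite sqrrN. Qed.

Lemma normcX z n : normc (z ^+ n) = normc z ^+ n.
Proof.
elim: n => [|n IH]; first by rewrite !expr0 normc1.
by rewrite !exprS normcM IH.
Qed.

Lemma normc_real (r : R) : normc r%:C = `|r|.
Proof. by rewrite /= expr0n /= addr0 sqrtr_sqr. Qed.

Lemma normc_eq0 z : (normc z == 0) = (z == 0).
Proof.
apply/eqP/eqP => [/eq0_normc //|->]; exact: normc0.
Qed.

Lemma normc_sum (I : Type) (s : seq I) (P : pred I) (u : I -> R[i]) :
  normc (\sum_(i <- s | P i) u i) <= \sum_(i <- s | P i) normc (u i).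
Proof.
elim/big_rec2: _ => [|i a b _ IH]; first by rewrite normc0.
by rewrite (le_trans (normcD _ _)) // lerD2l.
Qed.

Lemma Re_le_normc z : `|complex.Re z| <= normc z.
Proof.
case: z => a b /=; rewrite -sqrtr_sqr ler_sqrt ?lerDl ?sqr_ge0 //.
by rewrite addr_ge0 ?sqr_ge0.
Qed.

Lemma Im_le_normc z : `|complex.Im z| <= normc z.
Proof.
case: z => a b /=; rewrite -sqrtr_sqr ler_sqrt ?lerDr ?sqr_ge0 //.
by rewrite addr_ge0 ?sqr_ge0.
Qed.

Lemma normc_leD z : normc z <= `|complex.Re z| + `|complex.Im z|.
Proof.
have -> : z = (complex.Re z)%:C + 'i%C * (complex.Im z)%:C by exact: complexE.
apply: le_trans (normcD _ _) _; rewrite normcM !normc_real.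
have -> : normc ('i%C : R[i]) = 1 by rewrite /= expr0n add0r expr1n sqrtr1.
by rewrite mul1r -complexE.
Qed.

Lemma normc_sqr z : normc z ^+ 2 = complex.Re z ^+ 2 + complex.Im z ^+ 2.
Proof. by case: z => a b; rewrite /= sqr_sqrtr // addr_ge0 ?sqr_ge0. Qed.

Lemma mulc_conj z : z * conjc z = (normc z ^+ 2)%:C.
Proof.
rewrite normc_sqr; case: z => a b /=.
by apply/eqP; rewrite eq_complex /=; apply/andP; split; apply/eqP; ring.
Qed.

(** This reduces convergence in R[i], whose norm and whose small radii are
    themselves in R[i], to convergence in R. *)
Lemma cvg_normcP (T : Type) (F : set_system T) (FF : Filter F)
    (u : T -> R[i]) (l : R[i]) :
  (u x : R[i]^o) @[x --> F] --> (l : R[i]^o) <->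
  normc (u x - l) @[x --> F] --> (0 : R).
Proof.
split => [/cvgrPdist_lt H|/cvgrPdist_lt H]; apply/cvgrPdist_lt => e e0.
  have e0' : 0 < e%:C by rewrite ltcR.
  apply: filterS (H _ e0') => t; rewrite norm_normc ltcR normc_distC => h.
  by rewrite sub0r normrN ger0_norm // normc_ge0.
have /complex_realP [k ke] : e \is Num.real by rewrite gtr0_real.
move: e0; rewrite {}ke ltcR => k0.
apply: filterS (H _ k0) => t; rewrite sub0r normrN ger0_norm ?normc_ge0 //.
by rewrite norm_normc ltcR normc_distC.
Qed.

Lemma cvg_Re (T : Type) (F : set_system T) (FF : Filter F)
    (u : T -> R[i]) (l : R[i]) :
  (u x : R[i]^o) @[x --> F] --> (l : R[i]^o) ->
  complex.Re (u x) @[x --> F] --> complex.Re l.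
Proof.
move/cvg_normcP/cvgrPdist_lt => H; apply/cvgrPdist_lt => e /H.
apply: filterS => t; rewrite sub0r normrN ger0_norm ?normc_ge0 //.
by apply: le_lt_trans; rewrite normc_distC -raddfB Re_le_normc.
Qed.

Lemma cvg_Im (T : Type) (F : set_system T) (FF : Filter F)
    (u : T -> R[i]) (l : R[i]) :
  (u x : R[i]^o) @[x --> F] --> (l : R[i]^o) ->
  complex.Im (u x) @[x --> F] --> complex.Im l.
Proof.
move/cvg_normcP/cvgrPdist_lt => H; apply/cvgrPdist_lt => e /H.
apply: filterS => t; rewrite sub0r normrN ger0_norm ?normc_ge0 //.
by apply: le_lt_trans; rewrite normc_distC -raddfB Im_le_normc.
Qed.

Lemma cvg_Complex (T : Type) (F : set_system T) (FF : Filter F)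
    (u : T -> R[i]) (a b : R) :
  complex.Re (u x) @[x --> F] --> a -> complex.Im (u x) @[x --> F] --> b ->
  (u x : R[i]^o) @[x --> F] --> ((a +i* b) : R[i]^o).
Proof.
move=> ha hb; apply/cvg_normcP.
apply: (@squeeze_cvgr _ F _ _ (fun=> 0)
  (fun t : T => `|complex.Re (u t) - a| + `|complex.Im (u t) - b|)).
- by apply: nearW => t; rewrite normc_ge0 /= (le_trans (normc_leD _)) // !raddfB.
- exact: cvg_cst.
- have -> : 0 = `|0 : R| + `|0 : R| by rewrite normr0 addr0.
  by apply: cvgD; apply: cvg_norm; apply/subr_cvg0.
Qed.

Lemma cvg_normc (T : Type) (F : set_system T) (FF : Filter F)
    (u : T -> R[i]) (l : R[i]) :
  (u x : R[i]^o) @[x --> F] --> (l : R[i]^o) ->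
  normc (u x) @[x --> F] --> normc l.
Proof.
move/cvg_normcP/cvgrPdist_lt => H; apply/cvgrPdist_lt => e /H.
apply: filterS => t; rewrite sub0r normrN ger0_norm ?normc_ge0 //.
apply: le_lt_trans; rewrite ler_norml (normc_distC _ l) normc_le_dist andbT.
by rewrite lerNl opprB normc_distC normc_le_dist.
Qed.

End Normc.

(** * Power series on the unit disc *)

Section PowerSeries.
Variable R : realType.
Implicit Types (a b u : nat -> R[i]) (z l : R[i]) (q A B : R).

Lemma geometric_sum_le q n m : 0 <= q < 1 ->
  \sum_(n <= k < m) q ^+ k <= q ^+ n / (1 - q).
Proof.
move=> /andP[q0 q1]; have q1' : 0 < 1 - q by rewrite subr_gt0.
rewrite ler_pdivlMr //; have [nm|mn] := leqP n m; last first.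
  by rewrite big_geq ?mul0r ?exprn_ge0 // ltnW.
rewrite -(subnKC nm); elim: (m - n)%N => [|d IH].
  by rewrite addn0 big_geq // mul0r exprn_ge0.
suff H : (\sum_(n <= k < n + d.+1) q ^+ k) * (1 - q) = q ^+ n - q ^+ (n + d.+1).
  by rewrite H lerBlDr lerDl exprn_ge0.
elim: d.+1 {IH} => [|e IH]; first by rewrite addn0 big_geq // mul0r subrr.
rewrite addnS big_nat_recr ?leq_addr //= mulrDl IH exprS; ring.
Qed.

Lemma normc_cvg_le u l c B n : (u x : R[i]^o) @[x --> \oo] --> (l : R[i]^o) ->
  (forall m, (n <= m)%N -> normc (u m - c) <= B) -> normc (l - c) <= B.
Proof.
move=> ul uB.
have H : (u x - c : R[i]^o) @[x --> \oo] --> (l - c : R[i]^o).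
  move/cvg_normcP: ul => ul; apply/cvg_normcP; under eq_fun => m.
    by rewrite opprB addrA subrK; over.
  exact: ul.
apply: (ler_cvg_to (cvg_normc _ H) (cvg_cst B)).
by exists n => // m /= nm; exact: uB.
Qed.

Lemma series_tail u l A q : 0 <= q < 1 ->
  (forall k, normc (u k) <= A * q ^+ k) ->
  (\sum_(0 <= k < n) u k : R[i]^o) @[n --> \oo] --> (l : R[i]^o) ->
  forall n, normc (l - \sum_(0 <= k < n) u k) <= A * (q ^+ n / (1 - q)).
Proof.
move=> q01 uA ul n; apply: (normc_cvg_le (n := n) ul) => m nm.
have A0 : 0 <= A.
  by have := le_trans (normc_ge0 _) (uA 0%N); rewrite expr0 mulr1.
rewrite (big_cat_nat (leq0n n) nm) /= addrAC subrr add0r.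
apply: le_trans (normc_sum _ _ _) _.
apply: le_trans (ler_sum _ (fun k _ => uA k)) _.
by rewrite -mulr_sumr ler_wpM2l // geometric_sum_le.
Qed.

Lemma real_series_cvg (v : nat -> R) A q : 0 <= q < 1 ->
  (forall k, `|v k| <= A * q ^+ k) -> cvgn (series v).
Proof.
move=> /andP[q0 q1] vA.
have A0 : 0 <= A.
  by have := le_trans (normr_ge0 _) (vA 0%N); rewrite expr0 mulr1.
apply: normed_cvg; apply: (@series_le_cvg _ _ (geometric A q)) => //.
- by move=> n; exact: normr_ge0.
- by move=> n; exact: (mulr_ge0 A0 (exprn_ge0 n q0)).
- by apply: is_cvg_geometric_series; rewrite ger0_norm.
Qed.

Lemma series_cvg u A q : 0 <= q < 1 ->
  (forall k, normc (u k) <= A * q ^+ k) ->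
  exists l, (\sum_(0 <= k < n) u k : R[i]^o) @[n --> \oo] --> (l : R[i]^o).
Proof.
move=> q01 uA.
have /cvg_ex [x hx] : cvgn (series (fun k => complex.Re (u k))).
  by apply: (real_series_cvg q01) => k; apply: le_trans (Re_le_normc _) (uA k).
have /cvg_ex [y hy] : cvgn (series (fun k => complex.Im (u k))).
  by apply: (real_series_cvg q01) => k; apply: le_trans (Im_le_normc _) (uA k).
exists (x +i* y); apply: cvg_Complex.
  by under eq_fun do rewrite raddf_sum.
by under eq_fun do rewrite raddf_sum.
Qed.

Definition has_pseries a (F : R[i] -> R[i]) := forall z, normc z < 1 ->
  (\sum_(0 <= k < n) a k * z ^+ k : R[i]^o) @[n --> \oo] --> (F z : R[i]^o).

Lemma pseries_bounded a F r : has_pseries a F -> 0 <= r < 1 ->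
  exists A, forall k, normc (a k) * r ^+ k <= A.
Proof.
move=> aF /andP[r0 r1].
have rn : normc r%:C < 1 by rewrite normc_real ger0_norm.
have /cvg_ex H : exists l : R, normc (\sum_(0 <= k < n) a k * r%:C ^+ k) @[n --> \oo] --> l.
  by eexists; exact: cvg_normc (aF _ rn).
have [M [_ /(_ (M + 1))]] := cvg_seq_bounded H.
rewrite ltrDl ltr01 => /(_ isT) MP.
exists (M + 1 + (M + 1)) => k.
have -> : normc (a k) * r ^+ k = normc (a k * r%:C ^+ k).
  by rewrite normcM normcX normc_real ger0_norm.
have -> : a k * r%:C ^+ k = \sum_(0 <= j < k.+1) a j * r%:C ^+ j
    - \sum_(0 <= j < k) a j * r%:C ^+ j.
  by rewrite big_nat_recr //= addrAC subrr add0r.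
apply: le_trans (normcB _ _) _.
by apply: lerD; rewrite -[leLHS]ger0_norm ?normc_ge0 //; exact: MP.
Qed.

(** Convergence on the whole open disc leaves room for a radius strictly between
    r and 1; the bound is uniform on the disc of radius r, as needed to integrate
    over circles. *)
Lemma pseries_geometric_bound a F r : has_pseries a F -> 0 <= r < 1 ->
  exists A q, [/\ 0 <= q < 1 & forall z, normc z <= r ->
    forall k, normc (a k * z ^+ k) <= A * q ^+ k].
Proof.
move=> aF /andP[r0 r1]; pose s := (1 + r) / 2.
have s0 : 0 < s by rewrite /s; lra.
have s1 : s < 1 by rewrite /s; lra.
have rs : r < s by rewrite /s; lra.
have [A AP] := @pseries_bounded _ _ s aF ltac:(by rewrite ltW).
exists A, (r / s); split.
  by rewrite divr_ge0 ?(ltW s0) //= ltr_pdivrMr // mul1r.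
move=> z zr k; rewrite normcM normcX.
apply: le_trans (_ : normc (a k) * s ^+ k * (r / s) ^+ k <= _); last first.
  by rewrite ler_wpM2r // exprn_ge0 // divr_ge0 // ltW.
rewrite -mulrA -exprMn mulrCA divff ?gt_eqF // mulr1 ler_wpM2l ?normc_ge0 //.
by rewrite lerXn2r ?nnegrE ?normc_ge0.
Qed.

(** Each of the n first powers of q is at least q^n, so n q^n is at most the sum
    1 + q + ... of the geometric series; the other factor q^n is kept to tend
    to 0. *)
Lemma natmul_expr_le q n : 0 <= q < 1 ->
  n%:R * (q ^+ 2) ^+ n <= q ^+ n / (1 - q).
Proof.
move=> /[dup] q01 /andP[q0 q1].
have h : n%:R * q ^+ n <= 1 / (1 - q).
  rewrite -(expr0 q); apply: le_trans (geometric_sum_le 0 n q01).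
  have -> : n%:R * q ^+ n = \sum_(0 <= k < n) q ^+ n.
    by rewrite sumr_const_nat subn0 mulr_natl.
  by apply: ler_sum_nat => k /andP[_ kn]; rewrite ler_wiXn2l ?(ltW q1) ?(ltnW kn).
have -> : (q ^+ 2) ^+ n = q ^+ n * q ^+ n by rewrite -exprM mul2n -addnn exprD.
by rewrite mulrA mulrC ler_wpM2l ?exprn_ge0 // -div1r.
Qed.

(** Summing over the triangle i + j < n by diagonals or by rows. *)
Lemma triangular_sum (f : nat -> nat -> R[i]) n :
  \sum_(0 <= k < n) \sum_(0 <= i < k.+1) f i (k - i)%N =
  \sum_(0 <= i < n) \sum_(0 <= j < n - i) f i j.
Proof.
elim: n => [|n IH]; first by rewrite !big_nil.
rewrite big_nat_recr //= {}IH.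
rewrite [X in _ = X]big_nat_recr //= subSn // subnn big_nat1.
rewrite [X in _ + X = _]big_nat_recr //= subnn addrA; congr (_ + _).
rewrite -big_split /=; apply: eq_big_nat => i /andP[_ lin].
by rewrite subSn ?(ltnW lin) // big_nat_recr.
Qed.

Definition cauchy_product a b k : R[i] := \sum_(0 <= i < k.+1) a i * b (k - i)%N.

Lemma cvg_normc_squeeze (u : nat -> R[i]) l (e : nat -> R) :
  (forall n, normc (u n - l) <= e n) -> e n @[n --> \oo] --> (0 : R) ->
  (u n : R[i]^o) @[n --> \oo] --> (l : R[i]^o).
Proof.
move=> ue e0; apply/cvg_normcP.
apply: (@squeeze_cvgr _ _ _ _ (fun=> 0) e) => //; last exact: cvg_cst.
by apply: nearW => n; rewrite normc_ge0 ue.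
Qed.

(** With F = A_n + O(q^n) and G = B_n + O(q^n), the n-th partial sum of the
    product series differs from F G by at most O(n q^n). *)
Lemma has_pseriesM a b F G : has_pseries a F -> has_pseries b G ->
  has_pseries (cauchy_product a b) (fun z => F z * G z).
Proof.
move=> aF bG z z1.
have z01 : 0 <= normc z < 1 by rewrite normc_ge0.
have [A [qa [qa01 aA]]] := pseries_geometric_bound aF z01.
have [B [qb [qb01 bB]]] := pseries_geometric_bound bG z01.
pose q := Num.max qa qb; pose s := Num.sqrt q.
have q01 : 0 <= q < 1.
  by rewrite /q le_max gt_max; case/andP: qa01 => -> ->; case/andP: qb01 => _ ->.
have q0 : 0 <= q by case/andP: q01.
have s01 : 0 <= s < 1.
  rewrite sqrtr_ge0 /= -sqrtr1 ltr_sqrt //; by case/andP: q01.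
have q1 : 0 < 1 - q by rewrite subr_gt0; case/andP: q01.
have A0 : 0 <= A.
  by have := le_trans (normc_ge0 _) (aA _ (lexx _) 0%N); rewrite expr0 mulr1.
have B0 : 0 <= B.
  by have := le_trans (normc_ge0 _) (bB _ (lexx _) 0%N); rewrite expr0 mulr1.
have aAq k : normc (a k * z ^+ k) <= A * q ^+ k.
  apply: le_trans (aA _ (lexx _) k) _; rewrite ler_wpM2l //.
  by rewrite lerXn2r ?nnegrE // ?le_max ?lexx //; case/andP: qa01.
have bBq k : normc (b k * z ^+ k) <= B * q ^+ k.
  apply: le_trans (bB _ (lexx _) k) _; rewrite ler_wpM2l //.
  by rewrite lerXn2r ?nnegrE // ?le_max ?lexx ?orbT //; case/andP: qb01.
have ta := series_tail q01 aAq (aF _ z1).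
have tb := series_tail q01 bBq (bG _ z1).
apply: (@cvg_normc_squeeze _ _ (fun n => A * (q ^+ n / (1 - q)) * normc (G z)
   + A * B / (1 - q) * (s ^+ n / (1 - s)))); last first.
  have cvq (t : R) : 0 <= t < 1 -> t ^+ n / (1 - t) @[n --> \oo] --> (0 : R).
    move=> /andP[t0 t1]; rewrite -[X in _ --> X](mul0r ((1 - t)^-1)).
    by apply: cvgMr_tmp; apply: cvg_expr; rewrite ger0_norm.
  rewrite -[X in _ --> X](addr0 0).
  apply: cvgD.
    rewrite -[X in _ --> X](mul0r (normc (G z))); apply: cvgMr_tmp.
    by rewrite -[X in _ --> X](mulr0 A); apply: cvgMl_tmp; exact: cvq.
  by rewrite -[X in _ --> X](mulr0 (A * B / (1 - q))); apply: cvgMl_tmp; exact: cvq.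
move=> n; rewrite normc_distC.
have -> : \sum_(0 <= k < n) cauchy_product a b k * z ^+ k =
   \sum_(0 <= i < n) a i * z ^+ i * \sum_(0 <= j < n - i) b j * z ^+ j.
  under [RHS]eq_bigr do rewrite mulr_sumr.
  rewrite -(triangular_sum (fun i j => a i * z ^+ i * (b j * z ^+ j))).
  apply: eq_bigr => k _; rewrite mulr_suml; apply: eq_big_nat => i /andP[_ ik].
  have {}ik : (i <= k)%N by [].
  by rewrite -[in z ^+ k](subnKC ik) exprD; ring.
have -> : F z * G z - \sum_(0 <= i < n) a i * z ^+ i * \sum_(0 <= j < n - i) b j * z ^+ j
  = (F z - \sum_(0 <= i < n) a i * z ^+ i) * G z
   + \sum_(0 <= i < n) a i * z ^+ i * (G z - \sum_(0 <= j < n - i) b j * z ^+ j).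
  under [X in _ = _ + X]eq_bigr do rewrite mulrBr.
  by rewrite sumrB -mulr_suml mulrBl addrA subrK.
apply: le_trans (normcD _ _) _; apply: lerD.
  by rewrite normcM ler_wpM2r ?normc_ge0.
apply: le_trans (normc_sum _ _ _) _.
apply: (@le_trans _ _ (\sum_(0 <= i < n) A * B / (1 - q) * q ^+ n)).
  apply: ler_sum_nat => i /andP[_ lin]; rewrite normcM.
  apply: le_trans (ler_pM (normc_ge0 _) (normc_ge0 _) (aAq i) (tb (n - i)%N)) _.
  rewrite -[in leRHS](subnKC (ltnW lin)) exprD le_eqVlt; apply/orP; left.
  by apply/eqP; ring.
rewrite sumr_const_nat subn0 -mulrnAr -mulr_natl ler_wpM2l //.
  by rewrite divr_ge0 ?mulr_ge0 // ltW.
by rewrite -(sqr_sqrtr q0) natmul_expr_le.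
Qed.

Lemma has_pseriesD a b F G : has_pseries a F -> has_pseries b G ->
  has_pseries (fun k => a k + b k) (fun z => F z + G z).
Proof.
move=> aF bG z z1; under eq_fun do (under eq_bigr do rewrite mulrDl; rewrite big_split).
by apply: cvgD; [exact: aF|exact: bG].
Qed.

Lemma has_pseries_cst (c : R[i]) :
  has_pseries (fun k => if k == 0%N then c else 0) (fun=> c).
Proof.
move=> z z1; apply: cvg_near_cst; exists 1%N => // n /= n0.
rewrite -(prednK n0) big_nat_recl //= expr0 mulr1 big1 ?addr0 // => k _.
by rewrite mul0r.
Qed.

Lemma has_pseries_sum (s : nat -> nat -> R[i]) (F : nat -> R[i] -> R[i]) N :
  (forall n, has_pseries (s n) (F n)) ->
  has_pseries (fun k => \sum_(0 <= n < N) s n k)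
    (fun z => \sum_(0 <= n < N) F n z).
Proof.
move=> sF; elim: N => [|N IH].
  have := @has_pseries_cst 0; congr has_pseries; apply/funext => t.
    by rewrite big_geq // if_same.
  by rewrite big_geq.
have := has_pseriesD IH (sF N); congr has_pseries; apply/funext => t;
  by rewrite big_nat_recr.
Qed.

Lemma le_of_exprn_le (t c K : R) : 0 <= t -> 0 <= c ->
  (forall n, t ^+ n <= K * c ^+ n) -> t <= c.
Proof.
move=> t0 c0 H; rewrite leNgt; apply/negP => ct.
have tp : 0 < t by apply: le_lt_trans ct.
suff : (1 : R) <= 0 by rewrite ler10.
have h : K * (c / t) ^+ n @[n --> \oo] --> (0 : R).
  rewrite -[X in _ --> X](mulr0 K); apply: cvgMl_tmp; apply: cvg_expr.
  by rewrite ger0_norm ?divr_ge0 // ltr_pdivrMr // mul1r.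
apply: (@ler_cvg_to _ \oo _ R (fun=> 1) (fun n => K * (c / t) ^+ n)
  _ _ (cvg_cst _) h); apply: nearW => n.
by rewrite exprMn exprVn mulrA ler_pdivlMr ?exprn_gt0 // mul1r.
Qed.

(** Evaluating the power F^n instead of F turns the crude bound
    |F(z)| <= c / (1 - |z|) into |F(z)|^n <= c^n / (1 - |z|); the factor
    1 / (1 - |z|) then disappears by taking n-th roots. *)
Lemma pseries_powers_le (F : R[i] -> R[i]) (a_ : nat -> nat -> R[i]) (c : R) : 0 <= c ->
  (forall n, has_pseries (a_ n) (fun z => F z ^+ n)) ->
  (forall n k, normc (a_ n k) <= c ^+ n) ->
  forall z, normc z < 1 -> normc (F z) <= c.
Proof.
move=> c0 aF ac z z1; apply: (@le_of_exprn_le _ _ (1 / (1 - normc z))) => //.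
  exact: normc_ge0.
move=> n; rewrite -normcX -[F z ^+ n]subr0.
have z01 : 0 <= normc z < 1 by rewrite normc_ge0.
have zc k : normc (a_ n k * z ^+ k) <= c ^+ n * normc z ^+ k.
  by rewrite normcM normcX ler_wpM2r // exprn_ge0 // normc_ge0.
have := series_tail z01 zc (aF n z z1) 0%N.
by rewrite big_geq // expr0 mulrC.
Qed.

(** The k-th coefficient of 1 / (1 - F) is the sum over n of the k-th
    coefficients of F^n.  The remainders of these sums are O(c^N) uniformly in k,
    so the power series of the partial sums of the geometric series of F
    approximate the limit series within O(c^N) at every point of the disc. *)
Lemma has_pseries_inv (F : R[i] -> R[i]) (a_ : nat -> nat -> R[i]) (c : R) : 0 <= c < 1 ->
  (forall n, has_pseries (a_ n) (fun z => F z ^+ n)) ->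
  (forall n k, normc (a_ n k) <= c ^+ n) ->
  exists b, has_pseries b (fun z => (1 - F z)^-1).
Proof.
move=> /[dup] c01 /andP[c0 c1] aF ac.
have ac1 k n : normc (a_ n k) <= 1 * c ^+ n by rewrite mul1r.
pose s N k := \sum_(0 <= n < N) a_ n k.
have [b bP] := choice (fun k => series_cvg c01 (ac1 k)).
have bs N k : normc (b k - s N k) <= c ^+ N / (1 - c).
  by rewrite -[leRHS]mul1r; exact: (series_tail c01 (ac1 k) (bP k) N).
exists b => z z1; apply/cvg_normcP/cvgrPdist_le => e e0.
have d0 : 0 < 1 - normc z by rewrite subr_gt0.
have c1' : 0 < 1 - c by rewrite subr_gt0.
have z01 : 0 <= normc z < 1 by rewrite normc_ge0.
have Fc := pseries_powers_le c0 aF ac z1.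
have F1 : 1 - c <= normc (1 - F z).
  apply: le_trans (normc_le_dist 1 (F z)); rewrite normc1; lra.
have Fn0 : 1 - F z != 0.
  by rewrite -normc_eq0 gt_eqF // (lt_le_trans c1').
pose K := (1 - normc z)^-1 / (1 - c) + (1 - c)^-1.
have K0 : 0 <= K by rewrite addr_ge0 ?mulr_ge0 ?invr_ge0 // ltW.
(* K c^N bounds the two errors made by truncating the geometric series at N:
   on the partial sums of the limit series, and on the value 1 / (1 - F z). *)
have [N NP] : exists N, K * c ^+ N <= e / 2.
  have h : K * c ^+ n @[n --> \oo] --> (0 : R).
    rewrite -[X in _ --> X](mulr0 K); apply: cvgMl_tmp; apply: cvg_expr.
    by rewrite ger0_norm.
  have e20 : 0 < e / 2 by rewrite divr_gt0.
  have [N _ /(_ N (leqnn N))] := cvgr_le _ h _ e20.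
  by exists N.
have sN := has_pseries_sum (N := N) (F := fun n z => F z ^+ n) aF z1.
have /cvg_normcP/cvgrPdist_le/(_ (e / 2)) := sN.
rewrite divr_gt0 // => /(_ isT); apply: filterS => n.
rewrite !sub0r !normrN !ger0_norm ?normc_ge0 // => nN.
set S := \sum_(0 <= k < n) b k * z ^+ k.
set SN := \sum_(0 <= k < n) (\sum_(0 <= j < N) a_ j k) * z ^+ k in nN *.
set G := \sum_(0 <= j < N) F z ^+ j in nN *.
have -> : S - (1 - F z)^-1 = (S - SN) + (SN - G) + (G - (1 - F z)^-1) by ring.
have h1 : normc (S - SN) <= c ^+ N / (1 - c) * (1 - normc z)^-1.
  rewrite /S /SN -sumrB; apply: le_trans (normc_sum _ _ _) _.
  apply: (@le_trans _ _ (\sum_(0 <= k < n) c ^+ N / (1 - c) * normc z ^+ k)).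
    apply: ler_sum => k _; rewrite -mulrBl normcM normcX ler_wpM2r ?exprn_ge0 ?normc_ge0 //.
    exact: bs.
  rewrite -mulr_sumr ler_wpM2l ?divr_ge0 ?exprn_ge0 ?(ltW c1') //.
  by have := geometric_sum_le 0 n z01; rewrite expr0 div1r.
have h2 : normc (G - (1 - F z)^-1) <= c ^+ N / (1 - c).
  have -> : G - (1 - F z)^-1 = - (F z ^+ N / (1 - F z)).
    apply: (mulIf Fn0); rewrite mulrBl mulVf // mulNr mulfVK //.
    rewrite /G; elim: (N) => [|m IH]; first by rewrite big_geq // mul0r expr0 sub0r.
    by rewrite big_nat_recr //= mulrDl addrAC IH exprS; ring.
  rewrite normc_opp normcM normcX normcV ler_pM ?exprn_ge0 ?invr_ge0 ?normc_ge0 //.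
    by rewrite lerXn2r ?nnegrE ?normc_ge0.
  by rewrite lef_pV2 ?posrE // (lt_le_trans c1').
apply: le_trans (normcD _ _) _.
apply: le_trans (lerD (normcD _ _) h2) _.
have -> : e = (c ^+ N / (1 - c) * (1 - normc z)^-1 + e / 2) + c ^+ N / (1 - c)
   + (e / 2 - K * c ^+ N) by rewrite /K; field; rewrite !gt_eqF.
by rewrite (le_trans (lerD (lerD h1 nN) (lexx _))) // lerDl subr_ge0.
Qed.

End PowerSeries.

(** * Measurable functions and trigonometric integrals on the circle *)

(** The measure [arc R] lives on an alias of R; this instance makes the lemmas on
    filters applicable to predicates on R itself. *)
#[local] Instance ae_arc_filter (R : realType) :
  @Filter R (nbhs (almost_everywhere (arc R))).
Proof. exact (ae_filter_ringOfSetsType (arc R)). Qed.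

Section Circle.
Variable R : realType.
Implicit Types (f g : R -> R[i]) (t : R).

Local Notation T := (measurableTypeR R).

Lemma cmeasurable_cst (c : R[i]) : cmeasurable (fun _ : R => c).
Proof. by split; exact: measurable_cst. Qed.

Lemma cmeasurableD f g : cmeasurable f -> cmeasurable g ->
  cmeasurable (fun t => f t + g t).
Proof.
move=> [f1 f2] [g1 g2]; split.
  under eq_fun do rewrite raddfD; exact: measurable_funD.
under eq_fun do rewrite raddfD; exact: measurable_funD.
Qed.

Lemma cmeasurableN f : cmeasurable f -> cmeasurable (fun t => - f t).
Proof.
move=> [f1 f2]; split.
  under eq_fun do rewrite raddfN; exact: measurable_funN.
under eq_fun do rewrite raddfN; exact: measurable_funN.
Qed.

Lemma cmeasurableM f g : cmeasurable f -> cmeasurable g ->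
  cmeasurable (fun t => f t * g t).
Proof.
move=> [f1 f2] [g1 g2]; split.
  have -> : (fun t => complex.Re (f t * g t)) =
    (fun t => complex.Re (f t) * complex.Re (g t) - complex.Im (f t) * complex.Im (g t)).
    by apply/funext => t; case: (f t) (g t) => [a b] [c d].
  by apply: measurable_funB; apply: measurable_funM.
have -> : (fun t => complex.Im (f t * g t)) =
    (fun t => complex.Re (f t) * complex.Im (g t) + complex.Im (f t) * complex.Re (g t)).
  by apply/funext => t; case: (f t) (g t) => [a b] [c d].
by apply: measurable_funD; apply: measurable_funM.
Qed.

Lemma cmeasurable_conj f : cmeasurable f -> cmeasurable (fconj f).
Proof.
move=> [f1 f2]; split.
  by have -> : (fun t => complex.Re (fconj f t)) = (fun t => complex.Re (f t))
    by apply/funext => t; rewrite /fconj; case: (f t).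
have -> : (fun t => complex.Im (fconj f t)) = (fun t => - complex.Im (f t))
  by apply/funext => t; rewrite /fconj; case: (f t).
exact: measurable_funN.
Qed.

Lemma measurable_normc_sqr f : cmeasurable f ->
  measurable_fun [set: T] (fun t => normc (f t) ^+ 2).
Proof.
move=> [f1 f2]; under eq_fun do rewrite normc_sqr.
by apply: measurable_funD; apply: measurable_funX.
Qed.

Lemma measurable_normc f : cmeasurable f ->
  measurable_fun [set: T] (fun t => normc (f t)).
Proof.
move=> mf.
have -> : (fun t => normc (f t)) = (fun t => Num.sqrt (normc (f t) ^+ 2)).
  by apply/funext => t; rewrite sqrtr_sqr ger0_norm // normc_ge0.
apply: (measurableT_comp (f := Num.sqrt : R -> R)); last exact: measurable_normc_sqr.
by apply: continuous_measurable_fun; exact: sqrt_continuous.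
Qed.

Lemma cmeasurableV f : cmeasurable f -> cmeasurable (fun t => (f t)^-1).
Proof.
move=> mf.
have mi : cmeasurable (fun t => ((normc (f t) ^+ 2)^-1)%:C).
  split; last exact: measurable_cst.
  have -> : (fun t => complex.Re ((normc (f t) ^+ 2)^-1)%:C) =
      (fun t => (normc (f t) ^+ 2) `^ (-1)).
    by apply/funext => t; rewrite powR_inv1 ?exprn_ge0 ?normc_ge0.
  apply: (measurableT_comp (measurable_powR _)); exact: measurable_normc_sqr.
have -> : (fun t => (f t)^-1) = (fun t => fconj f t * ((normc (f t) ^+ 2)^-1)%:C).
  apply/funext => t; rewrite /fconj.
  have [->|f0] := eqVneq (f t) 0; first by rewrite conjc0 mul0r invr0.
  apply: (mulfI f0); rewrite divff // mulrA mulc_conj -rmorphM /= divff //.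
  by rewrite expf_eq0 /= normc_eq0.
by apply: cmeasurableM => //; exact: cmeasurable_conj.
Qed.

Lemma cmeasurable_div f g : cmeasurable f -> cmeasurable g ->
  cmeasurable (fun t => f t / g t).
Proof. by move=> mf mg; apply: cmeasurableM => //; exact: cmeasurableV. Qed.

Lemma cmeasurableX f n : cmeasurable f -> cmeasurable (fun t => f t ^+ n).
Proof.
move=> mf; elim: n => [|n IH].
  under eq_fun do rewrite expr0; exact: cmeasurable_cst.
under eq_fun do rewrite exprS; exact: cmeasurableM.
Qed.

Lemma cmeasurable_expi : cmeasurable (@expi R).
Proof.
split; apply: continuous_measurable_fun; [exact: continuous_cos|exact: continuous_sin].
Qed.

Lemma cmeasurable_sum (u : nat -> R -> R[i]) n : (forall k, cmeasurable (u k)) ->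
  cmeasurable (fun t => \sum_(0 <= k < n) u k t).
Proof.
move=> mu; elim: n => [|n IH].
  under eq_fun do rewrite big_geq //; exact: cmeasurable_cst.
under eq_fun do rewrite big_nat_recr //; exact: cmeasurableD.
Qed.

Lemma cmeasurable_cvg (u : nat -> R -> R[i]) f : (forall n, cmeasurable (u n)) ->
  (forall t, (u n t : R[i]^o) @[n --> \oo] --> (f t : R[i]^o)) -> cmeasurable f.
Proof.
move=> mu uf; split.
  apply: (@measurable_fun_cvg _ _ _ _ (fun n t => complex.Re (u n t))).
    by move=> n; case: (mu n).
  by move=> t _; apply: cvg_Re; exact: uf.
apply: (@measurable_fun_cvg _ _ _ _ (fun n t => complex.Im (u n t))).
  by move=> n; case: (mu n).
by move=> t _; apply: cvg_Im; exact: uf.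
Qed.

Lemma normc_expi t : normc (expi t) = 1.
Proof. by rewrite /= cos2Dsin2 sqrtr1. Qed.

Lemma normc_dilate (r t : R) : 0 <= r -> normc (r%:C * expi t) = r.
Proof. by move=> r0; rewrite normcM normc_expi mulr1 normc_real ger0_norm. Qed.

Lemma cmeasurable_dilate (a : nat -> R[i]) (F : R[i] -> R[i]) (r : R) :
  has_pseries a F -> 0 <= r < 1 ->
  cmeasurable (dilate F r).
Proof.
move=> aF /andP[r0 r1].
apply: (@cmeasurable_cvg
  (fun n t => \sum_(0 <= k < n) a k * (r%:C * expi t) ^+ k)).
  move=> n; apply: cmeasurable_sum => k.
  apply: cmeasurableM; first exact: cmeasurable_cst.
  apply: cmeasurableX; apply: cmeasurableM; first exact: cmeasurable_cst.
  exact: cmeasurable_expi.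
by move=> t; apply: aF; rewrite normc_dilate.
Qed.

Lemma arc_setT : arc R [set: T] = 1%E.
Proof. exact: probability_setT. Qed.

Lemma bounded_arc_integrable (u : R -> R) B : measurable_fun [set: T] u ->
  (forall t, `|u t| <= B) -> (arc R).-integrable [set: T] (EFin \o u).
Proof.
move=> mu uB; apply: measurable_bounded_integrable => //.
  by rewrite /= arc_setT ltry.
exists B; split; first exact: num_real.
by move=> M BM t _ /=; rewrite (le_trans (uB t)) // ltW.
Qed.

Lemma Rintegral_arc_cst (c : R) : \int[arc R]_t c = c.
Proof. by rewrite Rintegral_cst //= arc_setT mulr1. Qed.

Lemma is_derive_mul (m t : R) : is_derive t 1 (fun s => m * s) m.
Proof.
have := @is_deriveZ R _ _ id m t 1 1 (is_derive_id t 1).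
by rewrite scaler1.
Qed.

Lemma is_derive_cosM (m t : R) :
  is_derive t 1 (fun s => cos (m * s)) (- sin (m * t) * m).
Proof. exact: (is_derive1_comp (is_derive_cos _) (is_derive_mul m t)). Qed.

Lemma is_derive_sinM (m t : R) :
  is_derive t 1 (fun s => sin (m * s)) (cos (m * t) * m).
Proof. exact: (is_derive1_comp (is_derive_sin _) (is_derive_mul m t)). Qed.

(** The integrand is shifted by the constant |x| + |y| to make it non-negative:
    its integral is then the mean over [0, 2 pi] for Lebesgue measure, given by an
    antiderivative. *)
Lemma trig_integral (m x y : R) : m != 0 ->
  cos (m * (pi *+ 2)) = 1 -> sin (m * (pi *+ 2)) = 0 ->
  \int[arc R]_t (x * cos (m * t) + y * sin (m * t)) = 0.
Proof.
move=> m0 c1 s0; pose B := `|x| + `|y|.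
pose w t := x * cos (m * t) + y * sin (m * t).
have wB t : `|w t| <= B.
  apply: le_trans (ler_normD _ _) _; rewrite !normrM; apply: lerD.
    by rewrite ler_piMr // ler_norml cos_geN1 cos_le1.
  by rewrite ler_piMr // ler_norml sin_geN1 sin_le1.
pose W t := B * t + (x / m * sin (m * t) - y / m * cos (m * t)).
have dW t : is_derive t 1 W (B + w t).
  have h1 := is_derive_mul B t.
  have h2 := @is_deriveZ R _ _ _ (x / m) t 1 _ (is_derive_sinM m t).
  have h3 := @is_deriveZ R _ _ _ (y / m) t 1 _ (is_derive_cosM m t).
  have := is_deriveD h1 (is_deriveB h2 h3).
  congr is_derive; rewrite /w /GRing.scale /=; field; exact: m0.
have cw : continuous (fun t => B + w t).
  move=> t.
  have hc := @is_deriveZ R _ _ _ x t 1 _ (is_derive_cosM m t).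
  have hs := @is_deriveZ R _ _ _ y t 1 _ (is_derive_sinM m t).
  have [+ _] := is_deriveD (is_derive_cst B t 1) (is_deriveD hc hs).
  by move/derivable1_diffP/differentiable_continuous.
have mw : measurable_fun [set: T] (fun t => B + w t) by exact: continuous_measurable_fun.
have mw' : measurable_fun [set: T] w.
  have -> : w = (fun t => (B + w t) - B) by apply/funext => t; ring.
  by apply: measurable_funB => //; exact: measurable_cst.
have E : (\int[arc R]_t (B + w t)%:E = B%:E)%E.
  rewrite /arc integral_uniform; last 2 first.
  - exact/measurable_EFinP.
  - move=> t; rewrite lee_fin; have := wB t; rewrite ler_norml => /andP[+ _]; lra.
  rewrite (@continuous_FTC2 _ _ W).
  - rewrite -EFinD -EFinM /W c1 s0 mulr0 !mulr0 cos0 sin0; congr EFin.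
    have p0 : (pi : R) != 0 by rewrite gt_eqF // pi_gt0.
    by move: (pi : R) p0 => P p0; field; apply/andP; split.
  - exact: two_pi_gt0.
  - exact: continuous_subspaceT.
  - split.
    + by move=> t _; case: (dW t).
    + apply: cvg_at_right_filter.
      by have [+ _] := dW 0; move/derivable1_diffP/differentiable_continuous; exact.
    + apply: cvg_at_left_filter.
      by have [+ _] := dW (pi *+ 2); move/derivable1_diffP/differentiable_continuous; exact.
  - by move=> t _; rewrite derive1E; apply: derive_val.
have : \int[arc R]_t (B + w t) = B by rewrite /Rintegral E.
rewrite RintegralD //=.
- by rewrite Rintegral_arc_cst => h; rewrite -[RHS](subrr B) -{1}h addrAC subrr add0r.
- exact: finite_measure_integrable_cst.
- exact: bounded_arc_integrable wB.
Qed.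
End Circle.

(** * Taylor coefficients and boundary values *)

Section Coefficients.
Variable R : realType.
Implicit Types (f g : R -> R[i]) (t : R) (a : nat -> R[i]) (F : R[i] -> R[i]).

Local Notation T := (measurableTypeR R).

Lemma expiD (s t : R) : expi (s + t) = expi s * expi t.
Proof.
rewrite /expi cosD sinD.
by apply/eqP; rewrite eq_complex /= eqxx /= addrC [X in _ + X]mulrC eqxx.
Qed.

Lemma expiX t n : expi t ^+ n = expi (n%:R * t).
Proof.
elim: n => [|n IH]; first by rewrite expr0 mul0r /expi cos0 sin0.
by rewrite exprS IH -expiD -natr1 mulrDl mul1r addrC.
Qed.

Lemma conj_expi t : (expi t)^* = expi (- t).
Proof. by rewrite /expi cosN sinN. Qed.

Lemma expi_conjX_mulX t k j :
  conjc (expi t) ^+ k * expi t ^+ j = expi ((j%:R - k%:R) * t).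
Proof. by rewrite conj_expi !expiX -expiD; congr expi; ring. Qed.

(** Orthogonality of the characters of the circle. *)
Lemma integral_expi (v : R[i]) k j :
  \int[arc R]_t complex.Re (v * (conjc (expi t) ^+ k * expi t ^+ j)) =
  if j == k then complex.Re v else 0.
Proof.
have [->|jk] := eqVneq j k.
  under eq_Rintegral do rewrite expi_conjX_mulX subrr mul0r /expi cos0 sin0 mulr1.
  exact: Rintegral_arc_cst.
(* The periodicity conditions of [trig_integral] are read off from
   e^(2 i pi) = 1. *)
have two_pi : expi (pi *+ 2 : R) = 1 by rewrite /expi cos2pi sin2pi.
have := expi_conjX_mulX (pi *+ 2) k j.
rewrite two_pi conjc1 !expr1n mulr1 => -[/esym c1 /esym s0].
under eq_Rintegral => t _.
  rewrite expi_conjX_mulX.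
  have -> : complex.Re (v * expi ((j%:R - k%:R) * t)) =
    complex.Re v * cos ((j%:R - k%:R) * t) + (- complex.Im v) * sin ((j%:R - k%:R) * t).
    by case: v => x y /=; rewrite mulNr.
  over.
by apply: trig_integral => //; rewrite subr_eq0 eqr_nat.
Qed.

Lemma integrable_Re_bounded f B : cmeasurable f -> (forall t, normc (f t) <= B) ->
  (arc R).-integrable [set: T] (EFin \o (fun t => complex.Re (f t))).
Proof.
move=> [mf _] fB; apply: (@bounded_arc_integrable _ _ B) => // t.
exact: le_trans (Re_le_normc _) (fB t).
Qed.

Lemma partial_sum_coef a (v : R[i]) (r : R) k n : 0 <= r ->
  \int[arc R]_t complex.Re (v * conjc (expi t) ^+ k
      * \sum_(0 <= j < n) a j * (r%:C * expi t) ^+ j) =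
  if (k < n)%N then complex.Re (v * a k) * r ^+ k else 0.
Proof.
move=> r0.
have cm (j : nat) : cmeasurable (fun t => a j * (r%:C * expi t) ^+ j).
  apply: cmeasurableM; first exact: cmeasurable_cst.
  apply: cmeasurableX; apply: cmeasurableM; first exact: cmeasurable_cst.
  exact: cmeasurable_expi.
have cw : cmeasurable (fun t => v * conjc (expi t) ^+ k).
  apply: cmeasurableM; first exact: cmeasurable_cst.
  by apply: cmeasurableX; apply: cmeasurable_conj; exact: cmeasurable_expi.
have nw t : normc (v * conjc (expi t) ^+ k) = normc v.
  by rewrite normcM normcX normc_conj normc_expi expr1n mulr1.
have na t j : normc (a j * (r%:C * expi t) ^+ j) = normc (a j) * r ^+ j.
  by rewrite normcM normcX normc_dilate.
elim: n => [|n IH].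
  under eq_Rintegral do rewrite big_geq // mulr0 /=.
  by rewrite Rintegral_arc_cst.
under eq_Rintegral do rewrite big_nat_recr //= mulrDr raddfD.
rewrite RintegralD //=.
- rewrite IH.
  under [X in _ + X = _]eq_Rintegral => t _.
    have -> : v * conjc (expi t) ^+ k * (a n * (r%:C * expi t) ^+ n) =
      (v * a n * r%:C ^+ n) * (conjc (expi t) ^+ k * expi t ^+ n).
      by rewrite exprMn; ring.
    over.
  rewrite integral_expi ltnS (leq_eqVlt k n).
  have [->|nk] := eqVneq n k.
    rewrite ltnn /= add0r -rmorphXn /=.
    by case: (v * a k) => x y; rewrite /= mulr0 subr0.
  by rewrite addr0.
- apply: (@integrable_Re_bounded _ (normc v * \sum_(0 <= j < n) normc (a j) * r ^+ j)).
    by apply: cmeasurableM => //; exact: cmeasurable_sum.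
  move=> t; rewrite normcM nw ler_wpM2l ?normc_ge0 //.
  apply: le_trans (normc_sum _ _ _) _.
  by apply: ler_sum => j _; rewrite na.
- apply: (@integrable_Re_bounded _ (normc v * (normc (a n) * r ^+ n))).
    exact: cmeasurableM.
  by move=> t; rewrite normcM nw na.
Qed.

(** Integrate F(r e^(it)) e^(-ikt) times the conjugate of a_k, which makes the
    k-th coefficient equal to |a_k|^2 r^k; the series is replaced by its partial
    sums, which are uniformly close to F on the circle of radius r. *)
Lemma pseries_coef_le a F (r M : R) k : has_pseries a F -> 0 <= r < 1 ->
  (forall t, normc (dilate F r t) <= M) ->
  normc (a k) * r ^+ k <= \int[arc R]_t normc (dilate F r t).
Proof.
move=> aF /[dup] r01 /andP[r0 r1] FM.
have [ak0|ak0] := eqVneq (a k) 0.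
  by rewrite ak0 normc0 mul0r; apply: Rintegral_ge0 => t _; exact: normc_ge0.
have ak : 0 < normc (a k) by rewrite lt_neqAle normc_ge0 eq_sym normc_eq0 ak0.
have [A [q [q01 aA]]] := pseries_geometric_bound aF r01.
have mF := cmeasurable_dilate aF r01.
have iF : (arc R).-integrable [set: T] (EFin \o (fun t => normc (dilate F r t))).
  apply: (@bounded_arc_integrable _ _ M); first exact: measurable_normc.
  by move=> t; rewrite ger0_norm ?normc_ge0.
pose e n := A * (q ^+ n / (1 - q)).
have H n : (k < n)%N ->
    normc (a k) * r ^+ k <= \int[arc R]_t normc (dilate F r t) + e n.
  move=> kn; rewrite -(ler_pM2l ak) mulrA -expr2.
  have -> : normc (a k) ^+ 2 = complex.Re (conjc (a k) * a k).
    by rewrite mulrC mulc_conj.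
  have := partial_sum_coef a (conjc (a k)) k n r0; rewrite kn => <-.
  rewrite -[e n]Rintegral_arc_cst -RintegralD //; last first.
    exact: finite_measure_integrable_cst.
  rewrite -RintegralZl //; last first.
    exact: (integrableD measurableT iF
      (finite_measure_integrable_cst (arc R) (e n) measurableT)).
  have key t : normc (conjc (a k) * conjc (expi t) ^+ k
     * \sum_(0 <= j < n) a j * (r%:C * expi t) ^+ j)
     <= normc (a k) * (normc (dilate F r t) + e n).
    rewrite normcM normcM normc_conj normcX normc_conj normc_expi expr1n mulr1.
    rewrite ler_wpM2l ?normc_ge0 //.
    have z1 : normc (r%:C * expi t) < 1 by rewrite normc_dilate.
    have zr : normc (r%:C * expi t) <= r by rewrite normc_dilate.
    have h := series_tail q01 (aA _ zr) (aF _ z1) n.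
    rewrite -lerBlDl; apply: le_trans h; rewrite normc_distC.
    exact: normc_le_dist.
  apply: le_Rintegral => //.
  - apply: (@integrable_Re_bounded _ (normc (a k) * (M + e n))).
      apply: cmeasurableM.
        apply: cmeasurableM; first exact: cmeasurable_cst.
        by apply: cmeasurableX; apply: cmeasurable_conj; exact: cmeasurable_expi.
      apply: cmeasurable_sum => j.
      apply: cmeasurableM; first exact: cmeasurable_cst.
      apply: cmeasurableX; apply: cmeasurableM; first exact: cmeasurable_cst.
      exact: cmeasurable_expi.
    by move=> t; rewrite (le_trans (key t)) // ler_wpM2l ?normc_ge0 // lerD2r.
  - apply: (@bounded_arc_integrable _ _ (normc (a k) * (M + e n))).
      apply: measurable_funM; first exact: measurable_cst.
      by apply: measurable_funD; [exact: measurable_normc|exact: measurable_cst].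
    move=> t; rewrite ger0_norm; last by rewrite (le_trans _ (key t)) ?normc_ge0.
    by rewrite ler_wpM2l ?normc_ge0 // lerD2r.
  - by move=> t _; rewrite (le_trans (ler_norm _)) // (le_trans (Re_le_normc _)).
have e0 : \int[arc R]_t normc (dilate F r t) + e n @[n --> \oo]
    --> \int[arc R]_t normc (dilate F r t).
  rewrite -[X in _ --> X]addr0; apply: cvgD; first exact: cvg_cst.
  rewrite -[X in _ --> X](mulr0 A); apply: cvgMl_tmp.
  rewrite -[X in _ --> X](mul0r ((1 - q)^-1)); apply: cvgMr_tmp.
  by apply: cvg_expr; case/andP: q01 => q0 q1; rewrite ger0_norm.
apply: (@ler_cvg_to _ \oo _ R (fun=> normc (a k) * r ^+ k) _ _ _ (cvg_cst _) e0).
by exists k.+1.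
Qed.

(** The coefficient a_k r^k is a mean over the circle of radius r; dominated
    convergence as r tends to 1 transfers the bound to the boundary values. *)
Lemma pseries_coef_le_boundary a F f (M C : R) k : has_pseries a F ->
  (forall z, normc z < 1 -> normc (F z) <= M) ->
  boundary_fun F f -> cmeasurable f -> 0 <= C ->
  (\forall t \ae arc R, normc (f t) <= C) -> normc (a k) <= C.
Proof.
move=> aF FM Ff mf C0 fC.
pose r n : R := 1 - harmonic n.
have r01 n : 0 <= r n < 1.
  rewrite /r /harmonic /= subr_ge0 ltrBlDr ltrDl invr_gt0 ltr0n andbT.
  by rewrite invf_le1 ?ltr0n // ler1n.
have r1 : r n @[n --> \oo] --> (1 : R).
  rewrite -[X in _ --> X]subr0; apply: cvgB; first exact: cvg_cst.
  exact: cvg_harmonic.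
have FMr n t : normc (dilate F (r n) t) <= M.
  by apply: FM; case/andP: (r01 n) => h0 h1; rewrite normc_dilate.
have mF n := cmeasurable_dilate aF (r01 n).
have [|||||intf _ cvint] := @dominated_convergence _ T R (arc R) [set: T]
  measurableT (fun n t => (normc (dilate F (r n) t))%:E)
  (fun t => (normc (f t))%:E) (fun=> M%:E).
- by move=> n; apply/measurable_EFinP; exact: measurable_normc.
- by apply/measurable_EFinP; exact: measurable_normc.
- move: Ff; apply: filterS => t /cvg_normc Ft _.
  apply: cvg_EFin; first exact: nearW.
  move/cvg_at_leftP : Ft => /(_ r); apply; split => //.
  by move=> n; case/andP: (r01 n).
- exact: finite_measure_integrable_cst.
- apply: nearW => t n _ /=; rewrite lee_fin ger0_norm ?normc_ge0 //.
have ifin := integrable_fin_num measurableT intf.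
have {}cvint : \int[arc R]_t normc (dilate F (r n) t) @[n --> \oo]
    --> \int[arc R]_t normc (f t).
  by apply: fine_cvg; rewrite fineK.
apply: (@le_trans _ _ (\int[arc R]_t normc (f t))).
  have rk : normc (a k) * r n ^+ k @[n --> \oo] --> normc (a k).
    rewrite -[X in _ --> X]mulr1 -(expr1n _ k); apply: cvgMl_tmp.
    by elim: (k) => [|m IH]; [under eq_fun do rewrite expr0; rewrite expr0; exact: cvg_cst
      |under eq_fun do rewrite exprS; rewrite exprS; exact: cvgM].
  apply: (ler_cvg_to rk cvint); apply: nearW => n.
  exact: pseries_coef_le aF (r01 n) (FMr n).
rewrite -lee_fin fineK //.
rewrite -[leRHS]mule1 -arc_setT -integral_cst //.
apply: ae_ge0_le_integral => //.
- by move=> t _; rewrite lee_fin normc_ge0.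
- by apply/measurable_EFinP; exact: measurable_normc.
- by move: fC; apply: filterS => t ft _; rewrite lee_fin.
Qed.

End Coefficients.

(** * The algebra of bounded analytic functions and its action on the Hardy space *)

Section Spaces.
Variable R : realType.
Implicit Types (f g : R -> R[i]) (t : R) (a : nat -> R[i]) (F G : R[i] -> R[i]).

Local Notation T := (measurableTypeR R).

Lemma normLinfE f : normLinf f = ess_sup (arc R) (fun t => (normc (f t))%:E).
Proof.
rewrite /normLinf unlock /= arc_setT lte01; congr (ess_sup _ _).
by apply/funext => t /=; rewrite ger0_norm // normc_ge0.
Qed.

(** The essential supremum is itself an almost everywhere bound, and it is a
    non-negative real number. *)
Lemma normLinf_lt f (c : R) : (normLinf f < c%:E)%E ->
  exists2 b : R, 0 <= b < c & \forall t \ae arc R, normc (f t) <= b.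
Proof.
rewrite normLinfE => fc.
have ge0 : (0 <= ess_sup (arc R) (fun t => (normc (f t))%:E))%E.
  apply: ess_sup_gee; first by rewrite /= arc_setT lte01.
  by apply: nearW => t; rewrite lee_fin normc_ge0.
have H := ess_sup_ge (arc R) (fun t => (normc (f t))%:E).
move: fc ge0 H; case: (ess_sup _ _) => [b| |] //; rewrite lte_fin lee_fin => bc b0 H.
by exists b; [rewrite b0 bc|move: H; apply: filterS => t; rewrite lee_fin].
Qed.

Lemma LinfP f : Linf f <->
  cmeasurable f /\ exists M : R, \forall t \ae arc R, normc (f t) <= M.
Proof.
split=> [[mf]|[mf [M fM]]].
  rewrite normLinfE => h; split=> //.
  have H := ess_sup_ge (arc R) (fun t => (normc (f t))%:E).
  have ge0 : (0 <= ess_sup (arc R) (fun t => (normc (f t))%:E))%E.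
    apply: ess_sup_gee; first by rewrite /= arc_setT lte01.
    by apply: nearW => t; rewrite lee_fin normc_ge0.
  move: h ge0 H; case: (ess_sup _ _) => [b| |] // _ _ H.
  by exists b; move: H; apply: filterS => t; rewrite lee_fin.
split; first exact: mf.
rewrite normLinfE; apply: (@le_lt_trans _ _ M%:E); last exact: ltry.
by apply/ess_supP; move: fM; apply: filterS => t; rewrite lee_fin.
Qed.

Lemma normL2E f :
  normL2 f = ((\int[arc R]_t (normc (f t) ^+ 2)%:E) `^ 2^-1)%E.
Proof.
rewrite /normL2 unlock; congr (_ `^ _)%E; apply: eq_integral => t _.
by rewrite abse_EFin ger0_norm ?normc_ge0 // poweR_EFin powR_mulrn ?normc_ge0.
Qed.

Lemma normL2_lty f : (normL2 f < +oo)%E <->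
  (\int[arc R]_t (normc (f t) ^+ 2)%:E < +oo)%E.
Proof.
have i0 : (0 <= \int[arc R]_t (normc (f t) ^+ 2)%:E)%E.
  by apply: integral_ge0 => t _; rewrite lee_fin sqr_ge0.
rewrite normL2E; split; last exact: poweR_lty.
by move: i0; case: (integral _ _ _) => [b _ _| _|] //; rewrite ?ltry // poweRyr // invr_neq0.
Qed.

Lemma normL2_le f g (K : R) : cmeasurable f -> cmeasurable g -> 0 <= K ->
  (\forall t \ae arc R, normc (f t) <= K * normc (g t)) ->
  (normL2 f <= K%:E * normL2 g)%E.
Proof.
move=> mf mg K0 fg; rewrite !normL2E.
have -> : K%:E = ((K ^+ 2)%:E `^ 2^-1)%E.
  by rewrite poweR_EFin -powR_mulrn // -powRrM mulfV ?pnatr_eq0 // powRr1.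
rewrite -poweRM ?lee_fin ?sqr_ge0 //; last first.
  by apply: integral_ge0 => t _; rewrite lee_fin sqr_ge0.
apply: gt0_ler_poweR; rewrite ?invr_ge0 //.
- rewrite in_itv /= leey andbT.
  by apply: integral_ge0 => t _; rewrite lee_fin sqr_ge0.
- rewrite in_itv /= leey andbT mule_ge0 ?lee_fin ?sqr_ge0 //.
  by apply: integral_ge0 => t _; rewrite lee_fin sqr_ge0.
rewrite -ge0_integralZl //; last 3 first.
- by apply/measurable_EFinP; exact: measurable_normc_sqr.
- by move=> t _; rewrite lee_fin sqr_ge0.
- by rewrite lee_fin sqr_ge0.
apply: ae_ge0_le_integral => //.
- by move=> t _; rewrite lee_fin sqr_ge0.
- by apply/measurable_EFinP; exact: measurable_normc_sqr.
- by move=> t _; rewrite mule_ge0 // lee_fin sqr_ge0.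
- apply: measurable_funeM.
  by apply/measurable_EFinP; exact: measurable_normc_sqr.
- move: fg; apply: filterS => t h _; rewrite -EFinM lee_fin -exprMn.
  by rewrite lerXn2r ?nnegrE ?mulr_ge0 ?normc_ge0.
Qed.

Lemma L2_ae f g : cmeasurable g -> (\forall t \ae arc R, g t = f t) ->
  L2 f -> L2 g.
Proof.
move=> mg gf [mf f2]; split=> //.
apply: le_lt_trans (normL2_le (K := 1) mg mf ler01 _) _; last by rewrite mul1e.
by move: gf; apply: filterS => t ->; rewrite mul1r.
Qed.

Lemma L2M f g : L2 f -> Linf g -> L2 (fun t => f t * g t).
Proof.
move=> [mf f2] /LinfP [mg [M gM]]; split; first exact: cmeasurableM.
have {}f2 : (`|M|%:E * normL2 f < +oo)%E.
  have n0 : (0 <= normL2 f)%E by exact: Lnorm_ge0.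
  by move: f2 n0; case: (normL2 f) => [b| |] // _ _; rewrite -EFinM ltry.
apply: le_lt_trans (normL2_le (K := `|M|) (cmeasurableM mf mg) mf (normr_ge0 _) _) f2.
move: gM; apply: filterS => t gM; rewrite normcM mulrC ler_wpM2r ?normc_ge0 //.
exact: le_trans (ler_norm M).
Qed.

Lemma boundary_ae F f g : (\forall t \ae arc R, g t = f t) ->
  boundary_fun F f -> boundary_fun F g.
Proof. by apply: filterS2 => t ->. Qed.

Lemma boundaryD F G f g : boundary_fun F f -> boundary_fun G g ->
  boundary_fun (fun z => F z + G z) (fun t => f t + g t).
Proof. by apply: filterS2 => t; exact: cvgD. Qed.

Lemma boundaryM F G f g : boundary_fun F f -> boundary_fun G g ->
  boundary_fun (fun z => F z * G z) (fun t => f t * g t).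
Proof. by apply: filterS2 => t; exact: cvgM. Qed.

Lemma boundary_cst (c : R[i]) : boundary_fun (fun=> c) (fun _ : R => c).
Proof. by apply: nearW => t; exact: cvg_cst. Qed.

Lemma boundary_inv F f : (\forall t \ae arc R, f t != 1) -> boundary_fun F f ->
  boundary_fun (fun z => (1 - F z)^-1) (fun t => (1 - f t)^-1).
Proof.
apply: filterS2 => t f1 Ff; apply: (@cvgV R[i] R _ _ (fun r => 1 - dilate F r t)).
  by rewrite subr_eq0 eq_sym.
by apply: cvgB Ff; exact: cvg_cst.
Qed.

Lemma LinfD f g : Linf f -> Linf g -> Linf (fun t => f t + g t).
Proof.
move=> /LinfP [mf [M fM]] /LinfP [mg [N gN]]; apply/LinfP.
split; first exact: cmeasurableD.
exists (M + N); move: fM gN; apply: filterS2 => t h1 h2.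
exact: le_trans (normcD _ _) (lerD h1 h2).
Qed.

Lemma LinfM f g : Linf f -> Linf g -> Linf (fun t => f t * g t).
Proof.
move=> /LinfP [mf [M fM]] /LinfP [mg [N gN]]; apply/LinfP.
split; first exact: cmeasurableM.
exists (M * N); move: fM gN; apply: filterS2 => t h1 h2.
by rewrite normcM ler_pM ?normc_ge0.
Qed.

Lemma Linf_cst (c : R[i]) : Linf (fun _ : R => c).
Proof.
apply/LinfP; split; first exact: cmeasurable_cst.
by exists (normc c); exact: nearW.
Qed.

Lemma Linf_conj f : Linf f -> Linf (fconj f).
Proof.
move=> /LinfP [mf [M fM]]; apply/LinfP; split; first exact: cmeasurable_conj.
by exists M; move: fM; apply: filterS => t; rewrite /fconj normc_conj.
Qed.

Lemma Hinf_cst (c : R[i]) : Hinf (fun _ : R => c).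
Proof.
split; first exact: Linf_cst.
exists (fun=> c); last exact: boundary_cst.
split; last by exists (normc c).
by eexists; exact: has_pseries_cst.
Qed.

Lemma HinfD f g : Hinf f -> Hinf g -> Hinf (fun t => f t + g t).
Proof.
move=> [lf [F [[a aF] [M FM]] Ff]] [lg [G [[b bG] [N GN]] Gg]].
split; first exact: LinfD.
exists (fun z => F z + G z); last exact: (boundaryD Ff Gg).
split; first by eexists; exact: (has_pseriesD aF bG).
exists (M + N) => z z1; apply: le_trans (normcD _ _) _.
by apply: lerD; [exact: FM|exact: GN].
Qed.

Lemma HinfM f g : Hinf f -> Hinf g -> Hinf (fun t => f t * g t).
Proof.
move=> [lf [F [[a aF] [M FM]] Ff]] [lg [G [[b bG] [N GN]] Gg]].
split; first exact: LinfM.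
exists (fun z => F z * G z); last exact: (boundaryM Ff Gg).
split; first by eexists; exact: (has_pseriesM aF bG).
exists (M * N) => z z1; rewrite normcM ler_pM ?normc_ge0 //.
  exact: FM.
exact: GN.
Qed.

Lemma HinfB f g : Hinf f -> Hinf g -> Hinf (fun t => f t - g t).
Proof.
move=> hf hg; have -> : (fun t => f t - g t) = (fun t => f t + -1 * g t).
  by apply/funext => t; rewrite mulN1r.
exact: (HinfD hf (HinfM (Hinf_cst (-1)) hg)).
Qed.

Lemma Hinf_ae f g : cmeasurable g -> (\forall t \ae arc R, g t = f t) ->
  Hinf f -> Hinf g.
Proof.
move=> mg gf [/LinfP [mf [M fM]] [F hF Ff]]; split.
  by apply/LinfP; split=> //; exists M; move: gf fM; apply: filterS2 => t ->.
by exists F; [exact: hF|exact: (boundary_ae gf Ff)].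
Qed.

(** Each power f^n is bounded by c^n on the circle, so the Taylor coefficients of
    F^n are bounded by c^n too, which is what the geometric series of F requires;
    it also follows that |F| <= c in the disc, hence 1 / (1 - F) is bounded. *)
Lemma Hinf_inv f (c : R) : Hinf f -> 0 <= c < 1 ->
  (\forall t \ae arc R, normc (f t) <= c) -> Hinf (fun t => (1 - f t)^-1).
Proof.
move=> [lf [F [[a aF] [M FM]] Ff]] /[dup] c01 /andP[c0 c1] fc.
have [mf _] := lf.
have mfn n : cmeasurable (fun t => f t ^+ n) by exact: cmeasurableX.
have aF_ n : exists b, has_pseries b (fun z => F z ^+ n).
  elim: n => [|n [b bF]]; first by eexists; exact: (@has_pseries_cst _ 1).
  exists (cauchy_product a b).
  have -> : (fun z => F z ^+ n.+1) = (fun z => F z * F z ^+ n).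
    by apply/funext => z; rewrite exprS.
  exact: (has_pseriesM aF bF).
have [a_ aFn] := choice aF_.
have Ffn n : boundary_fun (fun z => F z ^+ n) (fun t => f t ^+ n).
  elim: n => [|n IH]; first exact: boundary_cst.
  have -> : (fun z => F z ^+ n.+1) = (fun z => F z * F z ^+ n).
    by apply/funext => z; rewrite exprS.
  have -> : (fun t => f t ^+ n.+1) = (fun t => f t * f t ^+ n).
    by apply/funext => t; rewrite exprS.
  exact: (boundaryM Ff IH).
have ac n k : normc (a_ n k) <= c ^+ n.
  apply: (pseries_coef_le_boundary (M := M ^+ n) k (aFn n) _ (Ffn n) (mfn n)).
  - move=> z /FM h; rewrite normcX lerXn2r ?nnegrE ?normc_ge0 //.
    exact: le_trans (normc_ge0 _) h.
  - exact: exprn_ge0.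
  - by move: fc; apply: filterS => t h; rewrite normcX lerXn2r ?nnegrE ?normc_ge0.
have inv_le (w : R[i]) : normc w <= c -> normc (1 - w)^-1 <= (1 - c)^-1.
  move=> wc; have := normc_le_dist 1 w; rewrite normc1 => h.
  have h0 : 0 < 1 - c by lra.
  have h1 : 1 - c <= normc (1 - w) by apply: le_trans h; lra.
  by rewrite normcV lef_pV2 ?posrE // (lt_le_trans h0).
have Fc := pseries_powers_le c0 aFn ac.
split.
  apply/LinfP; split.
    by apply: cmeasurableV; apply: cmeasurableD; [exact: cmeasurable_cst|exact: cmeasurableN].
  by exists (1 - c)^-1; move: fc; apply: filterS => t; exact: inv_le.
exists (fun z => (1 - F z)^-1).
  split; first exact: has_pseries_inv c01 aFn ac.
  by exists (1 - c)^-1 => z /Fc; exact: inv_le.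
apply: boundary_inv => //; move: fc; apply: filterS => t.
by apply: contraTneq => ->; rewrite normc1 -ltNge.
Qed.

Lemma H2_ae f g : cmeasurable g -> (\forall t \ae arc R, g t = f t) ->
  H2 f -> H2 g.
Proof.
move=> mg gf [lf [F hF Ff]]; split; first exact: (L2_ae mg gf lf).
by exists F; [exact: hF|exact: (boundary_ae gf Ff)].
Qed.

Lemma H2_0 : H2 (fun _ : R => 0).
Proof.
have n0 : normL2 (fun _ : R => 0) = 0%E.
  rewrite normL2E; under eq_integral do rewrite normc0 expr0n /=.
  by rewrite integral0 poweR0r // invr_neq0.
split; first by split; [exact: cmeasurable_cst|rewrite n0].
exists (fun=> 0); last exact: boundary_cst.
split; first by eexists; exact: has_pseries_cst.
by exists 0 => r _; rewrite n0.
Qed.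

Lemma H2M f g : H2 f -> Hinf g -> H2 (fun t => f t * g t).
Proof.
move=> [lf [F [[a aF] [M FM]] Ff]] [lg [G [[b bG] [N GN]] Gg]].
split; first exact: (L2M lf lg).
exists (fun z => F z * G z); last exact: (boundaryM Ff Gg).
split; first by eexists; exact: (has_pseriesM aF bG).
have N0 : 0 <= N.
  by apply: le_trans (normc_ge0 _) (GN 0 _); rewrite normc0.
exists (N * M) => r /[dup] r01 /andP[r0 r1].
rewrite EFinM; apply: le_trans (lee_wpmul2l _ (FM _ r01)); last by rewrite lee_fin.
apply: normL2_le => //.
- exact: (cmeasurable_dilate (has_pseriesM aF bG) r01).
- exact: (cmeasurable_dilate aF r01).
- apply: nearW => t; rewrite normcM mulrC ler_wpM2r ?normc_ge0 //.
  by apply: GN; rewrite normc_dilate.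
Qed.

End Spaces.

(** * Kernels of Toeplitz operators *)

Section Toeplitz.
Variable R : realType.
Implicit Types (f g k v w u : R -> R[i]) (t : R).

Local Notation T := (measurableTypeR R).

Lemma Num_conjE (z : R[i]) : Num.conj z = conjc z.
Proof. by []. Qed.

Lemma Rintegral_ae (x y : R -> R) :
  measurable_fun [set: T] x -> measurable_fun [set: T] y ->
  (\forall t \ae arc R, x t = y t) -> \int[arc R]_t x t = \int[arc R]_t y t.
Proof.
move=> mx my xy; rewrite /Rintegral; congr fine; apply: ae_eq_integral => //.
- exact/measurable_EFinP.
- exact/measurable_EFinP.
- by move: xy; apply: filterS => t -> _.
Qed.

Lemma dotL2_ae f v g w : cmeasurable f -> cmeasurable v ->
  cmeasurable g -> cmeasurable w ->
  (\forall t \ae arc R, f t * conjc (v t) = g t * conjc (w t)) ->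
  dotL2 f v = dotL2 g w.
Proof.
move=> mf mv mg mw E.
have [mf1 mf2] := cmeasurableM mf (cmeasurable_conj mv).
have [mg1 mg2] := cmeasurableM mg (cmeasurable_conj mw).
by rewrite /dotL2; congr (_ +i* _); apply: Rintegral_ae => //;
  move: E; apply: filterS => t; rewrite !Num_conjE => ->.
Qed.

Lemma H2_cmeasurable f : H2 f -> cmeasurable f.
Proof. by case=> -[]. Qed.

Lemma Hinf_cmeasurable f : Hinf f -> cmeasurable f.
Proof. by case=> -[]. Qed.

Lemma Linf_cmeasurable f : Linf f -> cmeasurable f.
Proof. by case. Qed.

Lemma H2M_l f g : Hinf g -> H2 f -> H2 (fun t => g t * f t).
Proof.
move=> hg hf; have -> : (fun t => g t * f t) = (fun t => f t * g t).
  by apply/funext => t; rewrite mulrC.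
exact: (H2M hf hg).
Qed.

Lemma ker_toeplitzP g f : Linf g -> ker_toeplitz g f <->
  H2 f /\ forall v, H2 v -> dotL2 (fun t => g t * f t) v = 0.
Proof.
move=> lg; have E : (fun t => g t * f t - 0) = (fun t => g t * f t).
  by apply/funext => t; rewrite subr0.
split=> [[hf [_ _ H]]|[hf H]]; first by split; [exact: hf|move=> v /H; rewrite E].
split; first exact: hf.
split.
- have -> : (fun t => g t * f t) = (fun t => f t * g t).
    by apply/funext => t; rewrite mulrC.
  by apply: (L2M _ lg); case: hf.
- exact: H2_0.
- by move=> v /H; rewrite E.
Qed.

(** If f is in ker T_g and k = f / w, then g' k v^* = g f (u v)^*; since u is a
    unit of H^oo, u v runs through H^2 when v does. *)
Lemma ker_toeplitz_factor g g' w w' u u' :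
  Linf g -> Linf g' -> Hinf w -> Hinf w' -> Hinf u -> Hinf u' ->
  (\forall t \ae arc R, w t * w' t = 1) ->
  (\forall t \ae arc R, u t * u' t = 1) ->
  (\forall t \ae arc R, g' t = conjc (u t) * g t * w t) ->
  ker_toeplitz g = fmul_set w (ker_toeplitz g').
Proof.
move=> lg lg' hw hw' hu hu' ww uu gg.
have [mg mg'] := (Linf_cmeasurable lg, Linf_cmeasurable lg').
apply/seteqP; split => f.
  move=> /(ker_toeplitzP _ lg) [hf H]; split; first exact: H2_cmeasurable.
  have hk := H2M_l hw' hf.
  exists (fun t => w' t * f t); last first.
    by move: ww; apply: filterS => t h _; rewrite mulrA h mul1r.
  apply/(ker_toeplitzP _ lg'); split; [exact: hk|move=> v hv].
  have huv := H2M_l hu hv.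
  rewrite -(H _ huv); apply: dotL2_ae.
  - exact: cmeasurableM mg' (H2_cmeasurable hk).
  - exact: H2_cmeasurable.
  - exact: cmeasurableM mg (H2_cmeasurable hf).
  - exact: (H2_cmeasurable huv).
  - move: ww gg; apply: filterS2 => t h ->; rewrite rmorphM /=.
    by rewrite -[in RHS](mul1r (g t * f t)) -[in RHS]h; ring.
move=> [mf [k /(ker_toeplitzP _ lg') [hk H] fk]].
have {}fk : \forall t \ae arc R, f t = w t * k t.
  by move: fk; apply: filterS => t; exact.
have hf : H2 f by exact: (H2_ae mf fk (H2M_l hw hk)).
apply/(ker_toeplitzP _ lg); split; [exact: hf|move=> v hv].
have huv := H2M_l hu' hv.
rewrite -(H _ huv); apply: dotL2_ae.
- exact: cmeasurableM mg mf.
- exact: H2_cmeasurable.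
- exact: cmeasurableM mg' (H2_cmeasurable hk).
- exact: (H2_cmeasurable huv).
- move: uu gg fk; apply: filterS3 => t h -> ->; rewrite rmorphM /=.
  have {}h : conjc (u t) * conjc (u' t) = 1 by rewrite -rmorphM h rmorph1.
  by rewrite -[LHS]mul1r -h; ring.
Qed.

Lemma L2_integrable f : L2 f ->
  (arc R).-integrable [set: T] (EFin \o (fun t => normc (f t) ^+ 2)).
Proof.
move=> [mf /normL2_lty f2]; apply/integrableP; split.
  by apply/measurable_EFinP; exact: measurable_normc_sqr.
by under eq_integral do rewrite /= ger0_norm ?sqr_ge0 //.
Qed.

Lemma eq_normL2 f g : L2 f -> L2 g ->
  \int[arc R]_t (normc (f t) ^+ 2) = \int[arc R]_t (normc (g t) ^+ 2) ->
  normL2 f = normL2 g.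
Proof.
move=> lf lg fg; rewrite !normL2E; congr (_ `^ _)%E.
rewrite -[LHS]fineK; last exact: (integrable_fin_num measurableT (L2_integrable lf)).
rewrite -[RHS]fineK; last exact: (integrable_fin_num measurableT (L2_integrable lg)).
by congr EFin; exact: fg.
Qed.

Lemma normc1_conj (z : R[i]) : normc z = 1 -> conjc z = z^-1.
Proof.
move=> z1; have z0 : z != 0 by rewrite -normc_eq0 z1 oner_neq0.
by apply: (mulfI z0); rewrite mulc_conj z1 expr1n divff.
Qed.

Lemma one_sub_neq0 (z : R[i]) (c : R) : normc z <= c -> c < 1 -> 1 - z != 0.
Proof.
move=> zc c1; rewrite subr_eq0; apply: contraTneq zc => <-.
by rewrite normc1 -ltNge.
Qed.

End Toeplitz.

(** * Pointwise identities on the circle *)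

Section Pointwise.
Variable R : realType.
Implicit Types (x a y e p k : R[i]) (c : R).

Lemma unimodular_neq0 x : normc x = 1 -> x != 0.
Proof. by move=> x1; rewrite -normc_eq0 x1 oner_neq0. Qed.

Lemma conjcM x y : conjc (x * y) = conjc x * conjc y.
Proof. exact: rmorphM. Qed.

Lemma conjcB x y : conjc (x - y) = conjc x - conjc y.
Proof. exact: rmorphB. Qed.

Lemma conjc_div x y : conjc (x / y) = conjc x / conjc y.
Proof. by rewrite conjcM conjc_inv. Qed.

Lemma conjc_one_sub x y : conjc (1 - y * x) = 1 - conjc y * conjc x.
Proof. by rewrite rmorphB rmorph1 rmorphM. Qed.

Lemma gamma_numerator x a y : normc x = 1 ->
  x * a - a * conjc y = x * a * conjc (1 - y * x).
Proof.
move=> x1; rewrite conjc_one_sub (normc1_conj x1).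
by field; exact: unimodular_neq0.
Qed.

Lemma normc_gamma x a y : normc x = 1 -> normc a = 1 -> 1 - y * x != 0 ->
  normc ((x * a - a * conjc y) / (1 - y * x)) = 1.
Proof.
move=> x1 a1 d0; rewrite gamma_numerator // normcM normcV !normcM normc_conj.
by rewrite x1 a1 !mul1r divff // normc_eq0.
Qed.

Lemma normc_frostman e p : normc e = 1 -> 1 - p * e != 0 ->
  normc ((e - conjc p) / (1 - p * e)) = 1.
Proof.
move=> e1 d0.
have h : e - conjc p = e * conjc (1 - p * e).
  by rewrite conjc_one_sub (normc1_conj e1); field; exact: unimodular_neq0.
rewrite h normcM normcV !normcM normc_conj e1 !mul1r divff //.
by rewrite normc_eq0.
Qed.

(** In the notations of the main theorem, x, a, y and e are the values of theta,
    alpha, h and gamma: both sides equal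
    e^* a (1 - p e) / (1 - p e)^*, because e = a x (1 - y x)^* / (1 - y x) gives
    x^* - y = e^* a (1 - y x)^*. *)
Lemma symbol_identity x a y e p c : normc x = 1 -> normc a = 1 ->
  1 - y * x != 0 -> 1 - p * e != 0 -> c != 0 ->
  e = (x * a - a * conjc y) / (1 - y * x) ->
  conjc ((e - conjc p) / (1 - p * e) / a) =
  conjc (c%:C / ((1 - p * e) * (1 - y * x))) * (conjc x - y)
    * (c%:C / (1 - p * e))^-1.
Proof.
move=> x1 a1 d0 b0 c0 eE.
have e1 : normc e = 1 by rewrite eE normc_gamma.
have e0 := unimodular_neq0 e1.
have C0 : c%:C != 0 by rewrite -normc_eq0 normc_real normr_eq0.
have D0 : conjc (1 - y * x) != 0 by rewrite conjc_eq0.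
have g : conjc x - y = e^-1 * a * conjc (1 - y * x).
  rewrite eE gamma_numerator // (normc1_conj x1).
  by move: (conjc _) D0 => D D0; field; rewrite D0 d0 !unimodular_neq0.
rewrite g !conjc_div conjcB conjcM conjcK conjc_real.
have B0 : conjc (1 - p * e) != 0 by rewrite conjc_eq0.
have a0 := unimodular_neq0 a1.
rewrite (normc1_conj e1) (normc1_conj a1).
move: (conjc (1 - y * x)) (conjc (1 - p * e)) D0 B0 => D B D0 B0.
by field; rewrite ?D0 ?B0 ?a0 ?e0 ?C0 ?b0.
Qed.

(** Put d = p e (1 - p e)^*.  As |a| = |e| = 1, the left-hand side is
    |k|^2 Re d, and |1 - p e|^2 = c^2 - 2 Re d. *)
Lemma crofoot_identity a e p k c : normc a = 1 -> normc e = 1 ->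
  1 - p * e != 0 -> c != 0 -> c ^+ 2 = 1 - normc p ^+ 2 ->
  complex.Re (conjc ((e - conjc p) / (1 - p * e) / a) * k
      * conjc (p * a * (1 - p * e) * k)) =
  c ^+ 2 / 2 * (normc k ^+ 2 - normc ((c%:C / (1 - p * e))^-1 * k) ^+ 2).
Proof.
move=> a1 e1 b0 c0 c2; apply: complexI.
have e0 := unimodular_neq0 e1; have a0 := unimodular_neq0 a1.
have C0 : c%:C != 0 by rewrite -normc_eq0 normc_real normr_eq0.
have C2 : c%:C ^+ 2 = 1 - p * conjc p.
  by rewrite -rmorphXn c2 rmorphB rmorph1 mulc_conj.
have B0 : conjc (1 - p * e) != 0 by rewrite conjc_eq0.
have bE : conjc (1 - p * e) = 1 - conjc p / e by rewrite conjc_one_sub (normc1_conj e1).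
have b1 : 1 - conjc p / e != 0 by rewrite -bE.
have b2 : e - conjc p != 0.
  apply: contra_neq b1 => h.
  have -> : 1 - conjc p / e = (e - conjc p) / e by field.
  by rewrite h mul0r.
have half : (2^-1 : R)%:C = 2^-1 :> R[i] by rewrite fmorphV rmorph_nat.
rewrite ReJ_add (rmorphM _ (c ^+ 2 / 2)) (rmorphM _ (c ^+ 2)) rmorphXn /= half.
rewrite rmorphB /= -!mulc_conj.
have one : (1 : R)%:C = 1 :> R[i] by [].
rewrite !(bE, conjcM, conjc_inv, conjcB, conjcK, conjc_real) one.
rewrite !(normc1_conj e1) !(normc1_conj a1).
transitivity (((1 - p * conjc p) - (1 - p * e) * (1 - conjc p / e)) * (k * conjc k) / 2).
  move: (conjc p) (conjc k) b1 b2 => q l b1 b2.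
  by field; rewrite ?a0 ?e0 ?b0 ?b1 ?b2.
rewrite -C2; move: (conjc p) (conjc k) b1 b2 => q l b1 b2.
by field; rewrite ?e0 ?b0 ?b1 ?b2 ?C0.
Qed.

End Pointwise.

(** * Inner functions and the isometric representation *)

Section Main.
Variable R : realType.
Implicit Types (f g k v w u theta alpha gamma h : R -> R[i]) (t : R) (p : R[i]).

Local Notation T := (measurableTypeR R).

Lemma Hinf_one_sub f : Hinf f -> Hinf (fun t => 1 - f t).
Proof. exact: (HinfB (Hinf_cst 1)). Qed.

Lemma crofoot_constant p : normc p < 1 ->
  Num.sqrt (1 - normc p ^+ 2) ^+ 2 = 1 - normc p ^+ 2 /\
  Num.sqrt (1 - normc p ^+ 2) != 0.
Proof.
move=> p1; have p2 : 0 < 1 - normc p ^+ 2.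
  by rewrite subr_gt0 -[ltRHS](expr1n _ 2) ltrXn2r ?nnegrE ?normc_ge0.
by rewrite sqr_sqrtr ?(ltW p2) // gt_eqF // sqrtr_gt0.
Qed.

(** The numerator of gamma is analytic because alpha h^* is the conjugate of
    alpha^* h, which is the condition defining the bounded part of K_alpha. *)
Lemma inner_gamma theta alpha h (b : R) : inner_fun theta -> inner_fun alpha ->
  model_space_inf alpha h -> 0 <= b < 1 -> (\forall t \ae arc R, normc (h t) <= b) ->
  inner_fun (gamma_fun theta alpha h).
Proof.
move=> [hth th1] [hal al1] [hh [u hu uE]] b01 hb.
have uE' t : alpha t * conjc (h t) = u t.
  by move/(congr1 (fun F => conjc (F t))): uE; rewrite /fconj conjcM !conjcK => <-.
have hht : \forall t \ae arc R, normc (h t * theta t) <= b.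
  move: hb th1; apply: filterS2 => t hb th1.
  by rewrite normcM th1 mulr1.
have hinv := Hinf_inv (HinfM hh hth) b01 hht.
split.
  have -> : gamma_fun theta alpha h =
      (fun t => (theta t * alpha t - u t) * (1 - h t * theta t)^-1).
    by apply/funext => t; rewrite /gamma_fun /fconj uE'.
  exact: (HinfM (HinfB (HinfM hth hal) hu) hinv).
move: hht th1 al1; apply: filterS3 => t hht th1 al1; apply: normc_gamma => //.
by apply: (one_sub_neq0 hht); case/andP: b01.
Qed.

(** By [crofoot_identity], |k|^2 - |k / m_p|^2 is a multiple of the real part of
    beta^* k v^* for some v in H^2, and beta^* k is orthogonal to H^2. *)
Lemma crofoot_weight_isometry alpha gamma p k :
  inner_fun alpha -> inner_fun gamma -> normc p < 1 ->
  Linf (fun t => frostman_shift p gamma t / alpha t) ->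
  model_space (fun t => frostman_shift p gamma t / alpha t) k ->
  normL2 (fun t => (crofoot_weight p gamma t)^-1 * k t) = normL2 k.
Proof.
move=> [hal al1] [hga ga1] p1 lb.
set beta := fun t => _ in lb *.
move=> /(ker_toeplitzP _ (Linf_conj lb)) [hk H].
pose c := Num.sqrt (1 - normc p ^+ 2).
have [c2 c0] : c ^+ 2 = 1 - normc p ^+ 2 /\ c != 0 := crofoot_constant p1.
have hpg := HinfM (Hinf_cst p) hga.
have hpg1 := Hinf_one_sub hpg.
have wE : (fun t => (crofoot_weight p gamma t)^-1 * k t) =
    (fun t => k t * ((1 - p * gamma t) * (c%:C)^-1)).
  by apply/funext => t; rewrite /crofoot_weight invf_div mulrC.
have hwk : H2 (fun t => (crofoot_weight p gamma t)^-1 * k t).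
  by rewrite wE; exact: (H2M hk (HinfM hpg1 (Hinf_cst _))).
have lk : L2 k by case: hk.
have lwk : L2 (fun t => (crofoot_weight p gamma t)^-1 * k t) by case: hwk.
(* With this test function, the integrand of the orthogonality relation is the
   left-hand side of [crofoot_identity]. *)
pose v t := p * alpha t * (1 - p * gamma t) * k t.
have hv : H2 v by exact: (H2M_l (HinfM (HinfM (Hinf_cst p) hal) hpg1) hk).
have := H _ hv; rewrite /dotL2 => -[ReD _].
apply: eq_normL2 => //.
have ik := L2_integrable lk; have iwk := L2_integrable lwk.
have mD : cmeasurable (fun t => fconj beta t * k t * conjc (v t)).
  apply: cmeasurableM; last exact: (cmeasurable_conj (H2_cmeasurable hv)).
  apply: cmeasurableM; last exact: (H2_cmeasurable hk).
  exact: (cmeasurable_conj (Linf_cmeasurable lb)).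
pose D t := normc (k t) ^+ 2 - normc ((crofoot_weight p gamma t)^-1 * k t) ^+ 2.
have mDD : measurable_fun [set: T] D.
  apply: measurable_funB; apply: measurable_normc_sqr.
    exact: (H2_cmeasurable hk).
  exact: (H2_cmeasurable hwk).
have iD : (arc R).-integrable [set: T] (EFin \o D).
  exact: (integrableB measurableT ik iwk).
have : \int[arc R]_t (c ^+ 2 / 2 * D t) = 0.
  rewrite -[RHS]ReD; apply: Rintegral_ae.
  - by apply: measurable_funM => //; exact: measurable_cst.
  - by case: mD.
  - move: al1 ga1; apply: filterS2 => t al1 ga1; rewrite Num_conjE.
    apply: esym; apply: (@crofoot_identity _ _ _ _ _ c) => //.
    apply: (@one_sub_neq0 _ _ (normc p)) => //.
    by rewrite normcM ga1 mulr1.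
rewrite RintegralZl // => /eqP; rewrite mulf_eq0 mulf_eq0 invr_eq0 pnatr_eq0 orbF.
rewrite expf_eq0 /= (negbTE c0) /= /D RintegralB //.
by rewrite subr_eq0 => /eqP.
Qed.

End Main.

Unset Implicit Arguments.

Theorem corollary6p7 (R : realType) (theta alpha h : R -> R[i]) (p : R[i]) :
  inner_fun theta -> inner_fun alpha ->
  model_space_inf alpha h -> (normLinf h < 1)%E ->
  normc p < 1 ->
  let gamma := gamma_fun theta alpha h in
  let gamma_p := frostman_shift p gamma in
  let m_p := crofoot_weight p gamma in
  inner_fun gamma /\
  (inner_divides alpha gamma_p ->
   isometric_representation (fun t => fconj theta t - h t)
     (fun t => (m_p t)^-1) (fun t => gamma_p t / alpha t)).
Proof.
move=> ith ial mh h1 p1 gamma gamma_p m_p.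
have [b b01 hb] := normLinf_lt h1; have /andP[_ b1] := b01.
have iga : inner_fun gamma by exact: inner_gamma ith ial mh b01 hb.
split; first exact: iga.
move=> hdiv.
have [hth th1] := ith; have [hal al1] := ial; have [hga ga1] := iga.
have [hh _] := mh.
pose beta t := gamma_p t / alpha t.
pose c := Num.sqrt (1 - normc p ^+ 2).
have [_ c0] : _ /\ c != 0 := crofoot_constant p1.
have C0 : c%:C != 0 by rewrite -normc_eq0 normc_real normr_eq0.
have hht : \forall t \ae arc R, normc (h t * theta t) <= b.
  by move: hb th1; apply: filterS2 => t hb th1; rewrite normcM th1 mulr1.
have hpg : \forall t \ae arc R, normc (p * gamma t) <= normc p.
  by move: ga1; apply: filterS => t ga1; rewrite normcM ga1 mulr1.
have d0 : \forall t \ae arc R, 1 - h t * theta t != 0.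
  by move: hht; apply: filterS => t /one_sub_neq0; exact.
have e0 : \forall t \ae arc R, 1 - p * gamma t != 0.
  by move: hpg; apply: filterS => t /one_sub_neq0; exact.
have Hht := HinfM hh hth.
have Hpg := HinfM (Hinf_cst p) hga.
have p01 : 0 <= normc p < 1 by rewrite normc_ge0.
have Hht' := Hinf_inv Hht b01 hht.
have Hpg' := Hinf_inv Hpg p01 hpg.
have mbeta : cmeasurable beta.
  apply: cmeasurable_div; last exact: (Hinf_cmeasurable hal).
  apply: cmeasurable_div; last exact: (Hinf_cmeasurable (Hinf_one_sub Hpg)).
  apply: cmeasurableD; first exact: (Hinf_cmeasurable hga).
  exact: cmeasurable_cst.
(* gamma_p / alpha is gamma_p alpha^* on the circle, the function assumed to be
   analytic. *)
have ibeta : inner_fun beta.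
  split.
    apply: (Hinf_ae mbeta _ hdiv); move: al1; apply: filterS => t al1.
    by rewrite /fconj normc1_conj.
  move: al1 ga1 e0; apply: filterS3 => t al1 ga1 e0.
  by rewrite normcM normcV al1 invr1 mulr1 normc_frostman.
have lbeta : Linf beta by case: ibeta => -[].
split; first exact: ibeta.
  (* The units of H^oo are w = 1 / m_p and u, given with their inverses. *)
  apply: (@ker_toeplitz_factor _ _ _ _ m_p
      (fun t => c%:C * ((1 - p * gamma t)^-1 * (1 - h t * theta t)^-1))
      (fun t => (1 - p * gamma t) * (1 - h t * theta t) * (c%:C)^-1)).
  - have [lth lh] := (Linf_conj (proj1 hth), proj1 hh).
    have -> : (fun t => fconj theta t - h t) = (fun t => fconj theta t + -1 * h t).
      by apply/funext => t; rewrite mulN1r.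
    exact: (LinfD lth (LinfM (Linf_cst (-1)) lh)).
  - exact: (Linf_conj lbeta).
  - have -> : (fun t => (m_p t)^-1) = (fun t => (1 - p * gamma t) * (c%:C)^-1).
      by apply/funext => t; rewrite /m_p /crofoot_weight invf_div.
    exact: (HinfM (Hinf_one_sub Hpg) (Hinf_cst _)).
  - exact: (HinfM (Hinf_cst c%:C) Hpg').
  - exact: (HinfM (Hinf_cst c%:C) (HinfM Hpg' Hht')).
  - exact: (HinfM (HinfM (Hinf_one_sub Hpg) (Hinf_one_sub Hht)) (Hinf_cst _)).
  - move: e0; apply: filterS => t e0; rewrite mulVf // /m_p /crofoot_weight.
    by rewrite mulf_neq0 ?invr_neq0.
  - move: e0 d0; apply: filterS2 => t e0 d0.
    by field; rewrite C0 e0 d0.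
  - have ath1 : \forall t \ae arc R, normc (alpha t) = 1 /\ normc (theta t) = 1.
      by move: al1 th1; apply: filterS2.
    move: ath1 d0 e0; apply: filterS3 => t [al1' th1'] d0' e0'.
    by rewrite -invfM; apply: symbol_identity.
by move=> k hk; exact: (crofoot_weight_isometry ial iga p1 lbeta hk).
Qed.
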